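(* Let $\Lambda$ be an $\mathbb{R}^d$-valued Lévy basis on $S\times\mathbb{R}^l$ with generating quadruple $(\gamma,\Sigma,Q,\pi)$, let $f:S\times\mathbb{R}^l\to M_{q\times d}(\mathbb{R})$ be a measurable function, and let $$(X_t)_{t\in\mathbb{R}^l}\stackrel{d}{=}\Big(\int_S\int_{\mathbb{R}^l}f(A,t-s)\,\Lambda(dA,ds)\Big)_{t\in\mathbb{R}^l}$$ be an MMA random field. Then $(X_t)_{t\in\mathbb{R}^l}$ is mixing.
   Context: Here $l,d,q\in\mathbb{N}$, $M_{q\times d}(\mathbb{R})$ is the set of real $q\times d$ matrices, and a prime denotes transposition. $S$ is a non-empty topological space with Borel $\sigma$-field $\mathcal{B}(S)$, $\pi$ is a probability measure on $(S,\mathcal{B}(S))$, $\lambda^l$ is Lebesgue measure on $\mathbb{R}^l$, $\Pi=\pi\otimes\lambda^l$, and $\mathcal{B}_0(S\times\mathbb{R}^l)$ is the collection of Borel sets of $S\times\mathbb{R}^l$ with finite $\Pi$-measure. A $d$-dimensional Lévy basis on $S\times\mathbb{R}^l$ is an $\mathbb{R}^d$-valued random measure $\Lambda=\{\Lambda(B):B\in\mathcal{B}_0(S\times\mathbb{R}^l)\}$ such that: (i) each $\Lambda(B)$ is infinitely divisible; (ii) $\Lambda(B_1),\dots,\Lambda(B_n)$ are independent for pairwise disjoint $B_1,\dots,B_n\in\mathcal{B}_0(S\times\mathbb{R}^l)$; (iii) for pairwise disjoint $B_1,B_2,\dots\in\mathcal{B}_0(S\times\mathbb{R}^l)$ with $\bigcup_n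 B_n\in\mathcal{B}_0(S\times\mathbb{R}^l)$, almost surely $\Lambda(\bigcup_nB_n)=\sum_n\Lambda(B_n)$. All Lévy bases are time-homogeneous and factorisable: $\mathbb{E}[e^{i\langle\theta,\Lambda(B)\rangle}]=e^{\psi(\theta)\Pi(B)}$ for all $\theta\in\mathbb{R}^d$, $B\in\mathcal{B}_0(S\times\mathbb{R}^l)$, where $$\psi(\theta)=i\langle\gamma,\theta\rangle-\tfrac12\langle\theta,\Sigma\theta\rangle+\int_{\mathbb{R}^d}\big(e^{i\langle\theta,x\rangle}-1-i\langle\theta,x\rangle\mathbf{1}_{[0,1]}(\|x\|)\big)Q(dx)$$ is the cumulant transform of an infinitely divisible law with characteristic triplet $(\gamma,\Sigma,Q)$; $(\gamma,\Sigma,Q,\pi)$ is the generating quadruple. A measurable $g:S\times\mathbb{R}^l\to M_{q\times d}(\mathbb{R})$ is $\Lambda$-integrable (the integral $\int_S\int_{\mathbb{R}^l} g(A,s)\Lambda(dA,ds)$ exists as a limit in probability of integrals of simple functions, in the sense of Rajput and Rosinski) if and only if $$\int_S\int_{\mathbb{R}^l}\Big\|g(A,s)\gamma+\int_{\mathbb{R}^d}g(A,s)x\big(\mathbf{1}_{[0,1]}(\|g(A,s)x\|)-\mathbf{1}_{[0,1]}(\|x\|)\big)Q(dx)\Big\|ds\,\pi(dA)<\infty,$$ $$\int_S\int_{\mathbb{R}^l}\|g(A,s)\Sigma g(A,s)'\|ds\,\pi(dA)<\infty,\qquad \int_S\int_{\mathbb{R}^l}\int_{\mathbb{R}^d}\min(1,\|g(A,s)x\|^2)Q(dx)ds\,\pi(dA)<\infty.$$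 The field $X_t=\int_S\int_{\mathbb{R}^l}f(A,t-s)\Lambda(dA,ds)$ is called an ($\mathbb{R}^q$-valued) mixed moving average (MMA) random field if $(A,s)\mapsto f(A,t-s)$ is $\Lambda$-integrable for every $t\in\mathbb{R}^l$. An MMA random field is infinitely divisible and strictly stationary. Let $\mathcal{T}:=\{(t_n)_{n\in\mathbb{N}}\subset\mathbb{R}^l:\lim_{n\to\infty}\|t_n\|_\infty=\infty\}$. A stationary $\mathbb{R}^q$-valued field $(X_t)$ is called mixing if for all $m\in\mathbb{N}$, all $\lambda=(s_1,\dots,s_m)',\mu=(p_1,\dots,p_m)'\in\mathbb{R}^{ml}$, all $\theta_1,\theta_2\in\mathbb{R}^{mq}$ and all $(t_n)\in\mathcal{T}$, $$\lim_{n\to\infty}\mathbb{E}\big[\exp(i\langle\theta_1,X_\lambda\rangle+i\langle\theta_2,X_{\tilde\mu_n}\rangle)\big]=\mathbb{E}\big[\exp(i\langle\theta_1,X_\lambda\rangle)\big]\,\mathbb{E}\big[\exp(i\langle\theta_2,X_\mu\rangle)\big],$$ where $X_\lambda:=(X_{s_1}',\dots,X_{s_m}')'\in\mathbb{R}^{mq}$ and $\tilde\mu_n=(p_1+t_n,\dots,p_m+t_n)'$. *)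

(* Defs.v *)
From HB Require Import structures.
From mathcomp Require Import all_boot all_order all_algebra.
From mathcomp Require Import all_classical all_reals all_analysis.
From mathcomp Require Import measurable_realfun.
From mathcomp Require Import complex.

Set Implicit Arguments.
Unset Strict Implicit.
Unset Printing Implicit Defensive.

Import Order.TTheory GRing.Theory Num.Theory.
Import numFieldNormedType.Exports.

Local Open Scope classical_set_scope.
Local Open Scope ring_scope.

Definition borel (T : ptopologicalType) := g_sigma_algebraType (@open T).

Fact matrix_display : measure_display.
Proof. exact: default_measure_display. Qed.

Section borel_matrix.
Context {R : realType} (m n : nat).

HB.instance Definition _ := @isMeasurable.Build
  matrix_display 'M[R]_(m, n)
  <<s @open 'M[R]_(m, n) >>
  (@sigma_algebra0 _ setT _) (@sigma_algebraC _ _) (@sigma_algebra_bigcup _ setT _).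

End borel_matrix.

Section matrix_measurability.
Context {R : realType}.

Lemma measurable_coord m n (i : 'I_m) (j : 'I_n) :
  measurable_fun [set: 'M[R]_(m, n)] (fun M => M i j).
Proof.
apply: (measurability _ (RGenOpens.measurableE R)) => _ [_ [a [b ->]] <-].
rewrite setTI; apply: sub_sigma_algebra.
by apply: open_comp; [move=> M _; exact: coord_continuous|exact: interval_open].
Qed.

Lemma open_bigcup_box m n (U : set 'M[R]_(m, n)) : open U ->
  U = \bigcup_(p in [set p : 'M[rat]_(m, n) * nat |
        ball (map_mx ratr p.1 : 'M[R]_(m, n)) p.2.+1%:R^-1 `<=` U])
      ball (map_mx ratr p.1 : 'M[R]_(m, n)) p.2.+1%:R^-1.
Proof.
move=> oU; apply/seteqP; split => [M UM|M [p /= +]]; last exact.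
have /nbhs_ballP[e /= e0 eU] : nbhs M U by exact: open_nbhs_nbhs.
have [k] := ltr_add_invr (divr_gt0 e0 (ltr0n R 2)); rewrite add0r => ke.
have k0 : 0 < k.+1%:R^-1 :> R by rewrite invr_gt0.
have rP i j : exists q : rat, `|M i j - ratr q| < k.+1%:R^-1.
  have /rat_in_itvoo[q] : M i j - k.+1%:R^-1 < M i j + k.+1%:R^-1.
    by rewrite ltrBlDr -addrA ltrDl addr_gt0.
  rewrite in_itv/= => /andP[q1 q2]; exists q.
  by rewrite ltr_distlC q1 q2.
pose N := \matrix_(i, j) projT1 (cid (rP i j)).
have NM : ball (map_mx ratr N : 'M[R]_(m, n)) k.+1%:R^-1 M.
  split => // i j; rewrite !mxE.
  by case: cid => q /=; rewrite /ball/= distrC.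
exists (N, k) => //= M' NM'; apply: eU.
by rewrite (splitr e); apply: ball_triangle (le_ball (ltW ke) (ball_sym NM)) (le_ball (ltW ke) NM').
Qed.

Lemma measurable_mxP d (T : measurableType d) m n (f : T -> 'M[R]_(m, n)) :
  measurable_fun [set: T] f <->
  forall i j, measurable_fun [set: T] (fun x => f x i j).
Proof.
split=> [mf i j|mf].
  by apply: (measurableT_comp (measurable_coord i j)).
apply: (@measurability _ _ _ _ setT _ (@open 'M[R]_(m, n))) => // _ [U oU <-].
rewrite setTI (open_bigcup_box oU) preimage_bigcup bigcup_mkcond.
apply: countable_bigcupT_measurable => [|p]; first exact: countableP.
case: ifPn => // _.
have -> : f @^-1` ball (map_mx ratr p.1 : 'M[R]_(m, n)) p.2.+1%:R^-1 =
  \bigcap_(ij : 'I_m * 'I_n) (fun x => f x ij.1 ij.2) @^-1`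
     ball (ratr (p.1 ij.1 ij.2) : R) p.2.+1%:R^-1.
  apply/seteqP; split => [x [_ /= H] [i j] _ /=|x /= H].
    by have := H i j; rewrite !mxE.
  split; first by rewrite invr_gt0.
  by move=> i j; rewrite !mxE; exact: (H (i, j)).
apply: fin_bigcap_measurable; first exact: finite_finset.
move=> [i j] _; rewrite -[X in measurable X]setTI; apply: mf => //.
exact: measurable_ball.
Qed.

End matrix_measurability.

Section lebesgue_cV.
Context {R : realType}.
Local Open Scope ereal_scope.

Definition cV_cons n (p : R * 'cV[R]_n) : 'cV[R]_n.+1 :=
  col_mx (const_mx p.1 : 'cV_1) p.2.

Fixpoint lebesgue_cV n : set 'cV[R]_n -> \bar R :=
  if n is n'.+1 then
    pushforward (@lebesgue_measure R \x lebesgue_cV (n := n'))%E (@cV_cons n')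
  else dirac (0%R : 'cV[R]_0).

Lemma measurable_cV_cons n : measurable_fun setT (@cV_cons n).
Proof.
apply/measurable_mxP => i j; rewrite (_ : (fun p => _) = fun p : R * 'cV[R]_n =>
    match fintype.split (i : 'I_(1 + n)) with inl _ => p.1 | inr k => p.2 k j end).
  case: fintype.split => k; first exact: measurable_fst.
  exact: (measurableT_comp (measurable_coord k j) measurable_snd).
by apply/funext => p; rewrite /cV_cons mxE; case: fintype.split => // k; rewrite mxE.
Qed.


Lemma lebesgue_cV_subproof n :
  exists mu : {sigma_finite_measure set 'cV[R]_n -> \bar R},
    (mu : set _ -> \bar R) = @lebesgue_cV n.
Proof.
elim: n => [|n [mu IH]] /=; first by exists (dirac (0%R : 'cV[R]_0)).
have /sigma_finiteP[F [FT Fnd Foo]] := sigma_finiteT (@lebesgue_measure R).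
have /sigma_finiteP[G [GT Gnd Goo]] := sigma_finiteT mu.
pose uncons (v : 'cV[R]_n.+1) : R * 'cV[R]_n :=
  (v ord0 ord0, dsubmx (v : 'cV_(1 + n))).
have consK p : uncons (cV_cons p) = p.
  case: p => x w; rewrite /uncons /cV_cons col_mxKd; congr pair.
  by rewrite mxE; case: fintype.splitP => //= j _; rewrite mxE.
have muncons : measurable_fun setT uncons.
  apply/measurable_fun_pairP; split; first exact: measurable_coord.
  apply/measurable_mxP => i j.
  rewrite (_ : (fun v => _) = fun v : 'cV[R]_n.+1 => v (rshift 1 i) j).
    exact: measurable_coord.
  by apply/funext => v /=; rewrite mxE.
pose nu : {measure set 'cV[R]_n.+1 -> \bar R} :=
  measure_function_pushforward__canonical__measure_function_Measure
    (@lebesgue_measure R \x mu)%E (@measurable_cV_cons n).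
have nu_sf : sigma_finite setT nu.
  exists (fun k => uncons @^-1` (F k `*` G k)).
    apply/esym/seteqP; split=> // v _.
    have [k _ Fk] : (\bigcup_k F k) (uncons v).1 by rewrite -FT.
    have [k' _ Gk'] : (\bigcup_k G k) (uncons v).2 by rewrite -GT.
    exists (maxn k k') => //; split.
    - exact: (subsetPset _ _ (Fnd _ _ (leq_maxl k k'))).
    - exact: (subsetPset _ _ (Gnd _ _ (leq_maxr k k'))).
  move=> k; have [mF Fk] := Foo k; have [mG Gk] := Goo k; split.
    by rewrite -[X in measurable X]setTI; apply: muncons => //; exact: measurableX.
  rewrite /nu /= /pushforward /=.
  rewrite (_ : _ @^-1` _ = F k `*` G k).
    by rewrite product_measure1E// lte_mul_pinfty// ge0_fin_numE.
  rewrite -comp_preimage (_ : uncons \o _ = id) ?preimage_id//.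
  exact/funext.
pose H := Measure_isSigmaFinite.Build _ _ _ nu nu_sf.
pose nu' : {sigma_finite_measure set 'cV[R]_n.+1 -> \bar R} :=
  HB.pack (nu : set _ -> \bar R) (Measure.on nu) H.
by exists nu'; rewrite /= -IH.
Qed.

Let lebesgue_cV0 n : @lebesgue_cV n set0 = 0.
Proof. by have [mu <-] := lebesgue_cV_subproof n; exact: measure0. Qed.

Let lebesgue_cV_ge0 n A : 0 <= @lebesgue_cV n A.
Proof. by have [mu <-] := lebesgue_cV_subproof n; exact: measure_ge0. Qed.

Let lebesgue_cV_sigma_additive n : semi_sigma_additive (@lebesgue_cV n).
Proof.
by have [mu <-] := lebesgue_cV_subproof n; exact: measure_semi_sigma_additive.
Qed.

HB.instance Definition _ n := isMeasure.Build _ _ _ (@lebesgue_cV n)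
  (lebesgue_cV0 n) (@lebesgue_cV_ge0 n) (@lebesgue_cV_sigma_additive n).

Let lebesgue_cV_sigma_finite n : sigma_finite setT (@lebesgue_cV n).
Proof. by have [mu <-] := lebesgue_cV_subproof n; exact: sigma_finiteT. Qed.

HB.instance Definition _ n := Measure_isSigmaFinite.Build _ _ _
  (@lebesgue_cV n) (@lebesgue_cV_sigma_finite n).

Lemma lebesgue_cV_box n (a b : 'cV[R]_n) : (forall i, a i 0 <= b i 0)%R ->
  lebesgue_cV [set v : 'cV[R]_n | forall i, (a i 0 <= v i 0 <= b i 0)%R] =
  (\prod_(i < n) (b i 0 - a i 0))%:E.
Proof.
elim: n => [|n IH] in a b *.
  move=> _; rewrite /= diracE big_ord0 mem_set//=; by case.
move=> ab; rewrite big_ord_recl EFinM.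
set a' : 'cV[R]_n := \col_i a (lift ord0 i) ord0.
set b' : 'cV[R]_n := \col_i b (lift ord0 i) ord0.
transitivity (lebesgue_measure `[a ord0 ord0, b ord0 ord0]%classic *
  lebesgue_cV [set v : 'cV[R]_n | forall i, (a' i 0 <= v i 0 <= b' i 0)%R]).
  rewrite -product_measure1E//=; last first.
    rewrite (_ : [set _ | _] = \bigcap_i
       ((fun v : 'cV[R]_n => v i ord0) @^-1` `[a' i ord0, b' i ord0]%classic)).
      apply: fin_bigcap_measurable; first exact: finite_finset.
      move=> i _; rewrite -[X in measurable X]setTI; exact: measurable_coord.
    by apply/seteqP; split => [v /= H i _ /=|v /= H i];
      have := H i; rewrite /= in_itv/=//; exact.
  rewrite /pushforward; congr (_ _); apply/seteqP; split => -[x w] /=.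
  - move=> H; rewrite in_itv/=; split.
      have := H ord0; rewrite /cV_cons mxE; case: fintype.splitP => //= j _.
      by rewrite mxE.
    move=> i; have := H (lift ord0 i); rewrite /cV_cons !mxE.
    case: fintype.splitP => [[[]//]|k] /= /eqP; rewrite /bump/= eqSS => /eqP ik.
    by rewrite (_ : k = i)//; apply/val_inj.
  - rewrite in_itv/= => -[xab H] i; rewrite /cV_cons mxE.
    case: fintype.splitP => [[j j1]|k] /= ik.
      rewrite mxE (_ : i = ord0)//; apply/val_inj => /=.
      by rewrite ik; move: j1; rewrite ltnS leqn0 => /eqP.
    have := H k; rewrite !mxE (_ : lift ord0 k = i)//; exact/val_inj.
rewrite lebesgue_measure_itv/= IH; last by move=> i; rewrite !mxE.
congr (_ * _).
  rewrite lte_fin; have := ab ord0; rewrite le_eqVlt => /predU1P[->|->//].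
  by rewrite ltxx subrr.
by congr EFin; apply: eq_bigr => i _; rewrite !mxE.
Qed.

End lebesgue_cV.

Section euclidean.
Context {R : realType}.

Definition dotp n (x y : 'cV[R]_n) : R := \sum_(i < n) x i 0 * y i 0.

(* Euclidean, unlike the library's sup norm [`|x|]. *)
Definition enorm n (x : 'cV[R]_n) : R := Num.sqrt (dotp x x).

End euclidean.

Section complex_valued.
Context {R : realType}.
Local Open Scope complex_scope.

Definition expC (z : R[i]) : R[i] :=
  (expR (complex.Re z))%:C * (cos (complex.Im z) +i* sin (complex.Im z)).

(* ['i%C] is [0 +i* 1]; ring_scope's ['i] is the one of numClosedFieldType. *)
Definition expCi (x : R) : R[i] := expC ('i%C * x%:C).

Lemma expCiE x : expCi x = cos x +i* sin x.
Proof.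
rewrite /expCi /expC /= !(mul0r, mul1r, mulr0) ?subrr ?addr0 ?add0r ?subr0 expR0.
by apply/eqP; rewrite eq_complex /= !(mul0r, mul1r) subr0 addr0 !eqxx.
Qed.

Definition integralC d (T : measurableType d) (mu : {measure set T -> \bar R})
    (f : T -> R[i]) : R[i] :=
  (\int[mu]_x complex.Re (f x)) +i* (\int[mu]_x complex.Im (f x)).

End complex_valued.

Section random_vectors.
Context {R : realType}.

Definition mutually_independent d (Omega : measurableType d)
    (P : probability Omega R) k n (X : 'I_n -> {RV P >-> 'cV[R]_k}) : Prop :=
  forall E : 'I_n -> set 'cV[R]_k, (forall i, measurable (E i)) ->
    P (\bigcap_(i in [set: 'I_n]) (X i @^-1` E i)) =
    (\prod_(i < n) P (X i @^-1` E i))%E.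

Definition infinitely_divisible d (Omega : measurableType d)
    (P : probability Omega R) k (X : {RV P >-> 'cV[R]_k}) : Prop :=
  forall n, (0 < n)%N ->
  exists (d' : measure_display) (Omega' : measurableType d')
    (P' : probability Omega' R) (Y : 'I_n -> {RV P' >-> 'cV[R]_k}),
  [/\ mutually_independent Y,
      forall i j E, measurable E -> P' (Y i @^-1` E) = P' (Y j @^-1` E) &
      forall E, measurable E ->
        P (X @^-1` E) = P' [set w | E (\sum_(i < n) Y i w)] ].

Definition cvg_in_probability d (Omega : measurableType d)
    (P : probability Omega R) k (X : nat -> Omega -> 'cV[R]_k)
    (Y : Omega -> 'cV[R]_k) : Prop :=
  forall eps : R, 0 < eps ->
    (fun n => P [set w | eps <= `|X n w - Y w|]) @ \oo --> 0%E.

End random_vectors.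

Section random_fields.
Context {R : realType} (l q : nat).

(* [s] lists the components of a point of (R^l)^m = R^(ml); the result stacks
   X_(s_0), ..., X_(s_(m-1)), in this order, into one vector of R^(mq). *)
Definition stack (Omega : Type) (X : 'cV[R]_l -> Omega -> 'cV[R]_q)
    m (s : 'I_m -> 'cV[R]_l) (w : Omega) : 'cV[R]_(m * q) :=
  (mxvec (\matrix_(i < m, j < q) X (s i) w j 0))^T.

Definition eq_fdd d (Omega : measurableType d) (P : probability Omega R)
    (X : 'cV[R]_l -> {RV P >-> 'cV[R]_q})
    d' (Omega' : measurableType d') (P' : probability Omega' R)
    (X' : 'cV[R]_l -> {RV P' >-> 'cV[R]_q}) : Prop :=
  forall m (s : 'I_m -> 'cV[R]_l) (E : set 'cV[R]_(m * q)), measurable E ->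
    P (stack X s @^-1` E) = P' (stack X' s @^-1` E).

(* Mixing is usually defined for strictly stationary fields only; stationarity
   is not repeated because the limit below implies it: with theta1 = 0 and
   |t_n| -> oo, the sequence (t_n) at the points p_i + h and the sequence
   (t_n + h) at the points p_i give the same left-hand side, so X at (p_i) and
   at (p_i + h) have the same characteristic function. (For l = 0 there is no
   such sequence, and R^0 is a single point.)
   [`|t n|] is the sup norm, and [R[i]^o] carries the usual topology of the
   complex numbers. *)
Definition mixing d (Omega : measurableType d) (P : probability Omega R)
    (X : 'cV[R]_l -> {RV P >-> 'cV[R]_q}) : Prop :=
  forall m (s p : 'I_m -> 'cV[R]_l) (theta1 theta2 : 'cV[R]_(m * q))
    (t : nat -> 'cV[R]_l),
  (fun n => `|t n|) @ \oo --> +oo ->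
  (fun n => integralC P (fun w =>
     expC ('i%C * (dotp theta1 (stack X s w))%:C%C +
           'i%C * (dotp theta2 (stack X (fun i => p i + t n) w))%:C%C))
     : R[i]^o) @ \oo -->
  (integralC P (fun w => expCi (dotp theta1 (stack X s w))) *
   integralC P (fun w => expCi (dotp theta2 (stack X p w))) : R[i]^o).

End random_fields.

Section levy_bases.
Context {R : realType} {S : ptopologicalType} (l d : nat).
Local Open Scope complex_scope.

(* Since R^l is second countable, the product sigma-algebra of this type is the
   Borel sigma-algebra of the product topology, for every S. *)
Local Notation SR := (borel S * 'cV[R]_l)%type.

Definition levy_measure (Q : {measure set 'cV[R]_d -> \bar R}) : Prop :=
  Q [set 0] = 0%E /\
  (\int[Q]_x (Num.min 1 (enorm x ^+ 2))%:E < +oo)%E.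

Definition characteristic_triplet (gamma : 'cV[R]_d) (Sigma : 'M[R]_d)
    (Q : {measure set 'cV[R]_d -> \bar R}) : Prop :=
  [/\ Sigma^T = Sigma, forall x : 'cV[R]_d, 0 <= dotp x (Sigma *m x) &
      levy_measure Q].

Definition cumulant (gamma : 'cV[R]_d) (Sigma : 'M[R]_d)
    (Q : {measure set 'cV[R]_d -> \bar R}) (theta : 'cV[R]_d) : R[i] :=
  'i%C * (dotp gamma theta)%:C - (2^-1 * dotp theta (Sigma *m theta))%:C +
  integralC Q (fun x =>
    expCi (dotp theta x) - 1 -
    'i%C * (dotp theta x * \1_`[0, 1]%classic (enorm x))%:C).

Context (rho : probability (borel S) R).

Definition Pi : set SR -> \bar R := (rho \x @lebesgue_cV R l)%E.

Definition B0 (B : set SR) : Prop := measurable B /\ (Pi B < +oo)%E.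

Context {dO : measure_display} {Omega : measurableType dO}
  {P : probability Omega R}.

(* Only the values of [Lambda] on [B0 rho] are meaningful. *)
Record levy_basis (gamma : 'cV[R]_d) (Sigma : 'M[R]_d)
    (Q : {measure set 'cV[R]_d -> \bar R})
    (Lambda : set SR -> {RV P >-> 'cV[R]_d}) : Prop := LevyBasis {
  levy_basis_triplet : characteristic_triplet gamma Sigma Q ;
  levy_basis_infdiv : forall B, B0 B -> infinitely_divisible (Lambda B) ;
  levy_basis_indep : forall n (B : 'I_n -> set SR),
    (forall i, B0 (B i)) -> trivIset setT B ->
    mutually_independent (fun i => Lambda (B i)) ;
  levy_basis_additive : forall B : nat -> set SR,
    (forall n, B0 (B n)) -> trivIset setT B -> B0 (\bigcup_n B n) ->
    {ae P, forall w, (fun n => \sum_(0 <= k < n) Lambda (B k) w) @ \oo -->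
                     Lambda (\bigcup_n B n) w} ;
  levy_basis_factorisable : forall (theta : 'cV[R]_d) (B : set SR), B0 B ->
    integralC P (fun w => expCi (dotp theta (Lambda B w))) =
    expC (cumulant gamma Sigma Q theta * (fine (Pi B))%:C) }.

End levy_bases.

Section integration.
Context {R : realType} {S : ptopologicalType} (l d q : nat).
Local Notation SR := (borel S * 'cV[R]_l)%type.
Context (rho : probability (borel S) R).

Record simple_integrand := SimpleIntegrand {
  si_size : nat ;
  si_val : 'I_si_size -> 'M[R]_(q, d) ;
  si_set : 'I_si_size -> set SR ;
  si_setP : forall i, B0 rho (si_set i) ;
  si_trivIset : trivIset setT si_set }.

Arguments si_val : clear implicits.
Arguments si_set : clear implicits.

Definition si_fun (h : simple_integrand) (z : SR) : 'M[R]_(q, d) :=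
  \sum_i \1_(si_set h i) z *: si_val h i.

Context {dO : measure_display} {Omega : measurableType dO}
  {P : probability Omega R}.

Definition si_integral (Lambda : set SR -> {RV P >-> 'cV[R]_d})
    (h : simple_integrand) (A : set SR) (w : Omega) : 'cV[R]_q :=
  \sum_i si_val h i *m Lambda (A `&` si_set h i) w.

(* [Y] is the Rajput-Rosinski integral of [g] over the whole space. The
   convergence of the integrals over every Borel set [A] is part of their
   definition of integrability; it makes [Y] independent, up to null sets, of
   the approximating sequence [h]. *)
Definition is_levy_integral (Lambda : set SR -> {RV P >-> 'cV[R]_d})
    (g : SR -> 'M[R]_(q, d)) (Y : {RV P >-> 'cV[R]_q}) : Prop :=
  exists h : nat -> simple_integrand,
  [/\ {ae (rho \x @lebesgue_cV R l)%E, forall z, (fun n => si_fun (h n) z) @ \oo --> g z},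
      forall A, measurable A -> exists YA : {RV P >-> 'cV[R]_q},
        cvg_in_probability P (fun n => si_integral Lambda (h n) A) YA &
      cvg_in_probability P (fun n => si_integral Lambda (h n) setT) Y].

Definition levy_integrable (Lambda : set SR -> {RV P >-> 'cV[R]_d})
    (g : SR -> 'M[R]_(q, d)) : Prop :=
  measurable_fun setT g /\ exists Y, is_levy_integral Lambda g Y.

Definition mma_kernel (f : SR -> 'M[R]_(q, d)) (t : 'cV[R]_l) (z : SR) :
  'M[R]_(q, d) := f (z.1, t - z.2).

Definition mma_field (Lambda : set SR -> {RV P >-> 'cV[R]_d})
    (f : SR -> 'M[R]_(q, d)) (Y : 'cV[R]_l -> {RV P >-> 'cV[R]_q}) : Prop :=
  forall t, levy_integrable Lambda (mma_kernel f t) /\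
            is_levy_integral Lambda (mma_kernel f t) (Y t).

End integration.

(* Main.v *)
(** For a real random variable [W] put [cosdef W = E (1 - cos W)].  It is
    computed from the characteristic function of [W] at 1, satisfies
    [cosdef (V + W) <= 2 (cosdef V + cosdef W)], and controls
    [|E exp(iV) - E exp(iW)|] through [cosdef (V - W)].

    The integral of a simple function [k] has characteristic function
    [exp (\int psi (k) dPi)], so its [cosdef] over [A] is at most
    [\int_A |psi (k)| dPi].  If simple functions [k_n] tend to 0 a.e. and their
    integrals over every Borel set [A] are Cauchy, a sliding hump argument yields
    one set [A] on which [\int_A |psi (k_n)|] is small infinitely often, and
    likewise on the complement; hence the integrals over the whole space tend
    to 0.  Therefore the stochastic integral does not depend on the approximating
    sequence, and, [Pi] being translation invariant, one simple function [v]
    supported in [|s| <= r] has translates approximating [X_(p + t)] uniformly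
    in [t].  For large [|t|] the simple functions used for [X_s] and for
    [X_(p + t)] have disjoint supports, so the characteristic function of the
    pair factorises up to an arbitrarily small error. *)

Require Import Defs.
From HB Require Import structures.
From mathcomp Require Import all_boot all_order all_algebra.
From mathcomp Require Import all_classical all_reals all_analysis.
From mathcomp Require Import measurable_realfun.
From mathcomp Require Import complex ring lra.

Set Implicit Arguments.
Unset Strict Implicit.
Unset Printing Implicit Defensive.

Import Order.TTheory GRing.Theory Num.Theory.
Import numFieldNormedType.Exports.

Import HBNNSimple.

Local Open Scope classical_set_scope.
Local Open Scope ring_scope.

(** * Characteristic functions of sums of independent variables *)

(** Mixing only involves characteristic functions of linear functionals, so [theta] is absorbed into
    the integrand and everything happens at the argument 1. There [cosdef] can stand in for
    convergence in probability. It is weaker, since a variable with values in the multiples of 2 pi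
    has [cosdef] 0, but it is determined by the law, so translation invariance of the characteristic
    functions passes to it exactly. The obstacle is that the integrands of an approximating sequence
    converge a.e. without a common integrable bound: [psi] may grow at infinity and [Pi] may be
    infinite. All that is known of [psi] is that it is bounded on a ball around 0 and tends to 0 at
    0. Dominated convergence therefore works only on sets of finite measure where the integrands are
    eventually bounded by 1. The mass of [psi] may still escape from each of these sets as the index
    grows, and the Cauchy property over one suitably chosen set, and over the whole space, is what
    rules this out. *)

Section weighted_integral.
Context {R : realType} d (T : measurableType d) d' (T' : measurableType d').
Variables (mu : {measure set T -> \bar R}) (X : T -> T').
Hypothesis mX : measurable_fun setT X.
Local Open Scope ereal_scope.

(** A form of independence: the weight [Z] is uncorrelated with every event defined by [X], and [c]
    stands for the mean of [Z]. The identity passes from indicators to simple functions by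
    linearity, then to [f] by monotone convergence. *)
Lemma ge0_integral_weight (Z : T -> R) (f : T' -> \bar R) (c : R) :
  measurable_fun setT Z -> (forall x, 0 <= Z x)%R -> (0 <= c)%R ->
  measurable_fun setT f -> (forall y, 0 <= f y) ->
  (forall E, measurable E ->
     \int[mu]_x ((Z x)%:E * (\1_E (X x))%:E) = c%:E * mu (X @^-1` E)) ->
  \int[mu]_x ((Z x)%:E * f (X x)) = c%:E * \int[mu]_x f (X x).
Proof.
move=> mZ Z0 c0 mf f0 ZE.
have mZ' : measurable_fun setT (fun x => (Z x)%:E) by exact/measurable_EFinP.
have mpre E : measurable E -> measurable (X @^-1` E).
  by move=> mE; rewrite -[X in measurable X]setTI; exact: mX.
have nn (g : {nnsfun T' >-> R}) :
    \int[mu]_x ((Z x)%:E * (g (X x))%:E) = c%:E * \int[mu]_x (g (X x))%:E.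
  have mI y : measurable_fun setT (fun x => (\1_(g @^-1` [set y]) (X x))%:E : \bar R).
    by apply/measurable_EFinP; apply: measurableT_comp mX.
  have gE x : (g (X x))%:E =
      \sum_(y \in range g) (y%:E * (\1_(g @^-1` [set y]) (X x))%:E).
    rewrite {1}fimfunE -fsumEFin//.
  have y0 y : range g y -> 0 <= y%:E by move=> [z _ <-]; rewrite lee_fin.
  (* Taking the maximum with 0 changes nothing for [y] in the range of [g], and makes the term
     nonnegative for all [y], as exchanging the integral with the finitely supported sum
     requires. *)
  pose h y x := maxe 0 y%:E * (\1_(g @^-1` [set y]) (X x))%:E.
  have gE' x : (g (X x))%:E = \sum_(y \in range g) h y x.
    rewrite gE; apply: eq_fsbigr => y /[!inE] /y0 yy; rewrite /h.
    by rewrite max_r//.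
  have h0 y x : 0 <= h y x.
    by apply: mule_ge0; rewrite ?le_max ?lexx// lee_fin.
  have mh y : measurable_fun setT (h y).
    by apply: emeasurable_funM; [exact: measurable_cst|exact: mI].
  under eq_integral => x _ do rewrite gE' ge0_mule_fsumr//.
  rewrite ge0_integral_fsum//; last 2 first.
    - by move=> y; apply: emeasurable_funM.
    - by move=> y x _; apply: mule_ge0 => //; rewrite lee_fin.
  under [in RHS]eq_integral => x _ do rewrite gE'.
  rewrite ge0_integral_fsum// ge0_mule_fsumr//; last first.
    by move=> y; apply: integral_ge0.
  apply: eq_fsbigr => y _; rewrite /h.
  under eq_integral => x _ do rewrite muleCA.
  have m0 : 0 <= maxe 0 y%:E by rewrite le_max lexx.
  rewrite ge0_integralZl//.
  rewrite ge0_integralZl//.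
  rewrite ZE// muleCA; congr (_ * (_ * _)).
  rewrite -(setIT (X @^-1` _)) -integral_indic//.
  - exact: mpre.
  - by apply: emeasurable_funM.
  - by move=> x _; apply: mule_ge0; rewrite lee_fin.
pose fn := nnsfun_approx measurableT mf.
have fnf x : (fn n x)%:E @[n --> \oo] --> f x.
  by apply: (@cvg_nnsfun_approx _ _ _ _ measurableT _ mf) => // y _.
have mfn n : measurable_fun setT (fun x => (fn n (X x))%:E).
  by apply/measurable_EFinP; apply: measurableT_comp mX.
have ndfn x n m : (n <= m)%N -> (fn n x)%:E <= (fn m x)%:E.
  by move=> nm; rewrite lee_fin; exact/lefP/nd_nnsfun_approx.
have -> : \int[mu]_x f (X x) = limn (fun n => \int[mu]_x (fn n (X x))%:E).
  rewrite -monotone_convergence//=; last first.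
  - by move=> x _ n m nm; exact: ndfn.
  - by move=> n x _; rewrite lee_fin.
  by apply: eq_integral => x _; apply/esym/cvg_lim => //; exact: fnf.
have -> : \int[mu]_x ((Z x)%:E * f (X x)) =
    limn (fun n => \int[mu]_x ((Z x)%:E * (fn n (X x))%:E)).
  rewrite -monotone_convergence//=; last first.
  - by move=> x _ n m nm /=; apply: lee_wpmul2l; [by rewrite lee_fin|exact: ndfn].
  - by move=> n x _; apply: mule_ge0 => //; rewrite lee_fin.
  - by move=> n; apply: emeasurable_funM.
  apply: eq_integral => x _; apply/esym/cvg_lim => //.
  exact: cvgeZl.
apply/cvg_lim => //; under eq_fun do rewrite nn.
apply: cvgeZl => //.
apply: ereal_nondecreasing_is_cvgn => n m nm.
apply: ge0_le_integral => //= x _; rewrite ?lee_fin//.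
by have := ndfn (X x) _ _ nm; rewrite lee_fin.
Qed.
End weighted_integral.

Section bounded_integration.
Context {R : realType} d (T : measurableType d).

Lemma bounded_integrable {P : probability T R} (W : T -> R) (M : R) :
  measurable_fun setT W -> (forall x, `|W x| <= M) ->
  P.-integrable setT (EFin \o W).
Proof.
move=> mW WM; apply: measurable_bounded_integrable => //.
  exact: le_lt_trans (probability_le1 P measurableT) (ltry _).
exists M; split; first exact: num_real.
by move=> y My x _; apply: le_trans (ltW My); exact: WM.
Qed.

Lemma EFin_Rintegral (mu : {measure set T -> \bar R}) (W : T -> R) :
  mu.-integrable setT (EFin \o W) ->
  (\int[mu]_x W x)%:E = (\int[mu]_x (W x)%:E)%E.
Proof. by move=> iW; rewrite /Rintegral fineK// integrable_fin_num. Qed.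

Lemma RintegrableD (mu : {measure set T -> \bar R}) (f g : T -> R) :
  mu.-integrable setT (EFin \o f) -> mu.-integrable setT (EFin \o g) ->
  mu.-integrable setT (EFin \o (fun x => f x + g x)).
Proof. by move=> mf mg; have := integrableD measurableT mf mg. Qed.

Lemma RintegrableZ (mu : {measure set T -> \bar R}) (k : R) (f : T -> R) :
  mu.-integrable setT (EFin \o f) ->
  mu.-integrable setT (EFin \o (fun x => k * f x)).
Proof. by move=> mf; have := integrableZl measurableT k mf. Qed.

(** Adding the bound [M] makes both factors nonnegative. The nonnegative case applies to [Z + M] and
    [f + M], and the extra terms of the expanded product cancel. *)
Lemma Rintegral_weight (P : probability T R) d' (T' : measurableType d')
    (X : T -> T') (Z : T -> R) (f : T' -> R) (M : R) :
  measurable_fun setT X -> measurable_fun setT Z -> measurable_fun setT f ->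
  (forall x, `|Z x| <= M) -> (forall y, `|f y| <= M) ->
  (forall E, measurable E -> \int[P]_x (Z x * \1_E (X x)) =
     \int[P]_x Z x * fine (P (X @^-1` E))) ->
  \int[P]_x (Z x * f (X x)) = \int[P]_x Z x * \int[P]_x f (X x).
Proof.
move=> mX mZ mf ZM fM ZE.
have mpre E : measurable E -> measurable (X @^-1` E).
  by move=> mE; rewrite -[X in measurable X]setTI; exact: mX.
have mfX : measurable_fun setT (fun x => f (X x)) by exact: measurableT_comp mX.
have iZ := @bounded_integrable P Z M mZ ZM.
have ifX : P.-integrable setT (EFin \o (f \o X)).
  exact: (@bounded_integrable P (f \o X) M mfX (fun x => fM (X x))).
have iZf : P.-integrable setT (EFin \o (fun x => Z x * f (X x))).
  apply: (@bounded_integrable P _ (M * M)); first exact: measurable_funM.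
  by move=> x; rewrite normrM ler_pM.
have iM (M' : R) : P.-integrable setT (EFin \o cst M').
  by apply: (@bounded_integrable P _ `|M'|); [exact: measurable_cst|].
have Mint (M' : R) : \int[P]_x M' = M'.
  by rewrite Rintegral_cst//= probability_setT mulr1.
have iE E (mE : measurable E) : P.-integrable setT (EFin \o (fun x => \1_E (X x))).
  apply: (@bounded_integrable P _ 1).
    by apply: measurableT_comp mX; exact: measurable_indic.
  by move=> x; rewrite /= ger0_norm// indicE; case: (_ \in _).
have iZE E (mE : measurable E) : P.-integrable setT (EFin \o (fun x => Z x * \1_E (X x))).
  apply: (@bounded_integrable P _ M).
    by apply: measurable_funM => //; apply: measurableT_comp mX; exact: measurable_indic.
  move=> x; rewrite normrM (le_trans _ (ZM x))// ler_piMr//.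
  by rewrite ger0_norm// indicE; case: (_ \in _).
have EP E : measurable E -> \int[P]_x \1_E (X x) = fine (P (X @^-1` E)).
  move=> mE; rewrite -(setIT (X @^-1` E)) -integral_indic//; exact: mpre.
have Z0 x : 0 <= Z x + M.
  by have := ZM x; rewrite ler_norml => /andP[+ _]; lra.
have f0 y : 0 <= f y + M.
  by have := fM y; rewrite ler_norml => /andP[+ _]; lra.
have iZM := RintegrableD iZ (iM M).
have ifM := RintegrableD ifX (iM M).
have c0 : 0 <= \int[P]_x (Z x + M) by apply: Rintegral_ge0.
have /= := @ge0_integral_weight R _ T _ T' P X mX (fun x => Z x + M)
  (fun y => (f y + M)%:E) (\int[P]_x (Z x + M)).
have -> : (\int[P]_x ((Z x + M)%:E * (f (X x) + M)%:E))%E =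
    (\int[P]_x (Z x * f (X x)) + M * \int[P]_x Z x
     + M * \int[P]_x f (X x) + M * M)%:E.
  under eq_integral => x _.
    rewrite -EFinM (_ : (Z x + M) * (f (X x) + M) =
      Z x * f (X x) + M * Z x + M * f (X x) + M * M); last by ring.
    over.
  have iMZ := RintegrableZ M iZ.
  have iMf := RintegrableZ M ifX.
  have i1 := RintegrableD iZf iMZ.
  have i2 := RintegrableD i1 iMf.
  rewrite -EFin_Rintegral; last exact: (RintegrableD i2 (iM _)).
  have /= -> := RintegralD measurableT i2 (iM (M * M)).
  have /= -> := RintegralD measurableT i1 iMf.
  have /= -> := RintegralD measurableT iZf iMZ.
  have /= -> := RintegralZl M measurableT iZ.
  have /= -> := RintegralZl M measurableT ifX.
  by rewrite Mint.
rewrite -EFin_Rintegral// -EFinM.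
have /= EZ := RintegralD measurableT iZ (iM M).
have /= -> := RintegralD measurableT ifX (iM M).
rewrite EZ Mint in c0 *.
have mfM : measurable_fun setT (fun y => (f y + M)%:E).
  by apply/measurable_EFinP; apply: measurable_funD.
have mZM : measurable_fun setT (fun x => Z x + M) by apply: measurable_funD.
move=> /(_ mZM Z0 c0 mfM f0) H.
suff {}/H : forall E, measurable E ->
    (\int[P]_x ((Z x + M)%:E * (\1_E (X x))%:E))%E =
    ((\int[P]_x Z x + M)%:E * P (X @^-1` E))%E by case; lra.
move=> E mE.
transitivity ((\int[P]_x (Z x * \1_E (X x)) + M * \int[P]_x \1_E (X x))%:E).
  have /= <- := RintegralZl M measurableT (iE _ mE).
  have /= <- := RintegralD measurableT (iZE _ mE) (RintegrableZ M (iE _ mE)).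
  rewrite EFin_Rintegral; last exact: (RintegrableD (iZE _ mE) (RintegrableZ M (iE _ mE))).
  by apply: eq_integral => x _; rewrite -EFinM mulrDl.
rewrite ZE// EP// -[P _ in RHS]fineK ?fin_num_measure ?mpre//.
  by rewrite -EFinM mulrDl.
exact: mpre.
Qed.

End bounded_integration.

Lemma integralCD {R : realType} d (T : measurableType d)
    (mu : {measure set T -> \bar R}) (f g : T -> R[i]) :
  mu.-integrable setT (EFin \o (fun z => complex.Re (f z))) ->
  mu.-integrable setT (EFin \o (fun z => complex.Im (f z))) ->
  mu.-integrable setT (EFin \o (fun z => complex.Re (g z))) ->
  mu.-integrable setT (EFin \o (fun z => complex.Im (g z))) ->
  integralC mu (fun z => f z + g z) = integralC mu f + integralC mu g.
Proof.
move=> iRf iIf iRg iIg; rewrite /integralC.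
have /= eR := RintegralD measurableT iRf iRg.
have /= eI := RintegralD measurableT iIf iIg.
apply/eqP; rewrite eq_complex /= -eR -eI; apply/andP; split; apply/eqP;
  by apply: eq_Rintegral => z _; case: (f z) (g z) => ? ? [].
Qed.

Section characteristic_functions.
Context {R : realType} d (T : measurableType d) (P : probability T R).
Local Open Scope complex_scope.

Definition charf (W : T -> R) : R[i] := integralC P (fun w => expCi (W w)).

Lemma charfE W : charf W = (\int[P]_w cos (W w)) +i* (\int[P]_w sin (W w)).
Proof.
by rewrite /charf /integralC; congr (_ +i* _); apply: eq_Rintegral => w _;
  rewrite expCiE.
Qed.

Lemma measurable_cosW (W : T -> R) : measurable_fun setT W ->
  measurable_fun setT (fun w => cos (W w)).
Proof.
move=> mW; apply: measurableT_comp mW.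
by apply: continuous_measurable_fun; exact: continuous_cos.
Qed.

Lemma measurable_sinW (W : T -> R) : measurable_fun setT W ->
  measurable_fun setT (fun w => sin (W w)).
Proof.
move=> mW; apply: measurableT_comp mW.
by apply: continuous_measurable_fun; exact: continuous_sin.
Qed.

Lemma cos_norm1 (x : R) : `|cos x| <= 1.
Proof. by rewrite ler_norml cos_geN1 cos_le1. Qed.

Lemma sin_norm1 (x : R) : `|sin x| <= 1.
Proof. by rewrite ler_norml sin_geN1 sin_le1. Qed.

Lemma integrable_cos (W : T -> R) : measurable_fun setT W ->
  P.-integrable setT (EFin \o (fun w => cos (W w))).
Proof.
move=> mW; apply: (@bounded_integrable _ _ _ P _ 1).
  exact: measurable_cosW.
by move=> w; exact: cos_norm1.
Qed.

Lemma integrable_sin (W : T -> R) : measurable_fun setT W ->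
  P.-integrable setT (EFin \o (fun w => sin (W w))).
Proof.
move=> mW; apply: (@bounded_integrable _ _ _ P _ 1).
  exact: measurable_sinW.
by move=> w; exact: sin_norm1.
Qed.

Lemma Rintegral_cst1 (r : R) : \int[P]_w r = r.
Proof. by rewrite Rintegral_cst//= probability_setT mulr1. Qed.

Section independent_sum.
Variables (k n : nat) (X : 'I_n -> {RV P >-> 'cV[R]_k}).
Variable phi : 'I_n -> 'cV[R]_k -> R.
Hypothesis mphi : forall i, measurable_fun setT (phi i).
Hypothesis indX : mutually_independent X.

Let A (j : nat) (E : 'I_n -> set 'cV[R]_k) : set T :=
  \bigcap_(i in [set i : 'I_n | (j <= i)%N]) (X i @^-1` E i).

Let W (j : nat) (w : T) : R := \sum_(i < n | (i < j)%N) phi i (X i w).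

Let mXE i E : measurable E -> measurable (X i @^-1` E).
Proof. by move=> mE; rewrite -[X in measurable X]setTI; exact: measurable_funP. Qed.

Let mA j E : (forall i, measurable (E i)) -> measurable (A j E).
Proof. by move=> mE; apply: fin_bigcap_measurable => // i _; exact: mXE. Qed.

Let mW j : measurable_fun setT (W j).
Proof.
rewrite /W (_ : (fun _ => _) = (fun w => \sum_(i < n)
    if (i < j)%N then phi i (X i w) else 0)); last first.
  by apply/funext => w; exact: big_mkcond.
apply: measurable_sum => i; case: (i < j)%N; last exact: measurable_cst.
exact: measurableT_comp.
Qed.

Let PA j E : (forall i, measurable (E i)) ->
  P (A j E) = (\prod_(i < n | (j <= i)%N) P (X i @^-1` E i))%E.
Proof.
move=> mE; pose E' (i : 'I_n) := if (j <= i)%N then E i else setT.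
have mE' i : measurable (E' i) by rewrite /E'; case: ifP.
have -> : A j E = \bigcap_(i in [set: 'I_n]) (X i @^-1` E' i).
  apply/seteqP; split => [w Aw i _|w Aw i /= ji].
    by rewrite /E' /=; case: ifPn => // ji; exact: Aw.
  by have := Aw i I; rewrite /E' ji.
rewrite indX// [RHS]big_mkcond/=; apply: eq_bigr => i _.
by rewrite /E'; case: ifP => // _; rewrite preimage_setT probability_setT.
Qed.

(** The variables enter the sum one at a time. The indicator of [A j E], an event on the variables
    not yet summed, keeps their joint independence available to the induction; the case [j = n] with
    full sets gives the product formula. *)
Lemma integral_indic_independent_sum j : (j <= n)%N ->
  forall E, (forall i, measurable (E i)) ->
  (\int[P]_w (\1_(A j E) w * cos (W j w))) +i*
  (\int[P]_w (\1_(A j E) w * sin (W j w))) =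
  (\prod_(i < n | (i < j)%N) charf (fun w => phi i (X i w))) *
  (fine (P (A j E)))%:C.
Proof.
elim: j => [|j IH] jn E mE.
  have W0 w : W 0 w = 0 by rewrite /W big_pred0.
  rewrite big_pred0// mul1r.
  under eq_Rintegral do rewrite W0 cos0 mulr1.
  under [X in _ +i* X]eq_Rintegral do rewrite W0 sin0 mulr0.
  rewrite Rintegral_cst1; congr (_ +i* _).
  by rewrite /Rintegral integral_indic ?setIT//; exact: mA.
pose i0 := Ordinal jn; set q := phi i0.
have WS w : W j.+1 w = W j w + q (X i0 w).
  rewrite /W (bigD1 i0)//= addrC; congr (_ + _); apply: eq_bigl => i.
  by rewrite ltnS [RHS]ltn_neqAle andbC.
have zS : \prod_(i < n | (i < j.+1)%N) charf (fun w => phi i (X i w)) =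
    (\prod_(i < n | (i < j)%N) charf (fun w => phi i (X i w))) *
    charf (fun w => q (X i0 w)).
  rewrite (bigD1 i0)//= mulrC; congr (_ * _); apply: eq_bigl => i.
  by rewrite ltnS [RHS]ltn_neqAle andbC.
set z := \prod_(i < n | (i < j)%N) _ in zS *.
have mZ1 : measurable_fun setT (\1_(A j.+1 E) : T -> R).
  by apply: measurable_indic; exact: mA.
have Z1 w : `|\1_(A j.+1 E) w| <= 1 :> R.
  by rewrite ger0_norm// indicE; case: (_ \in _).
have key F : measurable F ->
    (\int[P]_w (\1_(A j.+1 E) w * cos (W j w) * \1_F (X i0 w))) +i*
    (\int[P]_w (\1_(A j.+1 E) w * sin (W j w) * \1_F (X i0 w))) =
    z * (fine (P (A j.+1 E)))%:C * (fine (P (X i0 @^-1` F)))%:C.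
  (* An event on [X i0] is absorbed by changing [E] at [i0], which turns [A j.+1 E] into [A j E'].
     The induction hypothesis then yields exactly the weight condition of [Rintegral_weight]. *)
  move=> mF; pose E' (i : 'I_n) := if i == i0 then F else E i.
  have mE' i : measurable (E' i) by rewrite /E'; case: ifP.
  have AE : A j E' = A j.+1 E `&` (X i0 @^-1` F).
    apply/seteqP; split => [w Aw|w [Aw Fw] i /=]; last first.
      rewrite leq_eqVlt => /predU1P[ji|ji]; last first.
        rewrite /E' ifN; first exact: Aw.
        by apply: contraTneq ji => ->; rewrite ltnn.
      have -> : i = i0 by exact/val_inj.
      by rewrite /E' eqxx.
    split; last by have := Aw i0 (leqnn _); rewrite /E' eqxx.
    move=> i /= ji; have := Aw i (ltnW ji); rewrite /E' ifN//.
    by apply: contraTneq ji => ->; rewrite ltnn.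
  have IE w : \1_(A j E') w = \1_(A j.+1 E) w * \1_F (X i0 w) :> R.
    by rewrite AE indicI.
  transitivity ((\int[P]_w (\1_(A j E') w * cos (W j w))) +i*
                (\int[P]_w (\1_(A j E') w * sin (W j w)))).
    by congr (_ +i* _); apply: eq_Rintegral => w _; rewrite IE mulrAC.
  rewrite IH ?(ltnW jn)// -mulrA; congr (_ * _).
  rewrite -[RHS]rmorphM/=; congr (_%:C); rewrite -fineM; first congr fine; last 2 first.
  - by rewrite fin_num_measure//; exact: mA.
  - by rewrite fin_num_measure//; exact: mXE.
  rewrite !PA// (bigD1 i0)//= muleC; congr (_ * _)%E.
    apply: eq_big => [i|i ij].
      by rewrite [RHS]ltn_neqAle andbC eq_sym.
    by rewrite /E' ifN//; case/andP: ij.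
  by rewrite /E' eqxx.
have XT : fine (P (X i0 @^-1` setT)) = 1 by rewrite preimage_setT probability_setT.
have keyT : (\int[P]_w (\1_(A j.+1 E) w * cos (W j w))) +i*
            (\int[P]_w (\1_(A j.+1 E) w * sin (W j w))) =
            z * (fine (P (A j.+1 E)))%:C.
  rewrite -[RHS]mulr1 -[1 in RHS]/(1%:C) -XT -key//.
  by congr (_ +i* _); apply: eq_Rintegral => w _; rewrite indicT mulr1.
have wc (f : R -> R) : measurable_fun setT f -> (forall x : R, `|f x| <= 1) ->
  \int[P]_w (\1_(A j.+1 E) w * cos (W j w) * f (q (X i0 w))) =
  \int[P]_w (\1_(A j.+1 E) w * cos (W j w)) * \int[P]_w f (q (X i0 w)).
  move=> mf f1; apply: (@Rintegral_weight _ _ _ P _ _ (X i0) _ (f \o q) 1) => //.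
  - apply: measurable_funM => //; exact: measurable_cosW.
  - apply: measurableT_comp => //; exact: mphi.
  - by move=> x; rewrite normrM mulr_ile1// cos_norm1.
  - by move=> y; exact: f1.
  move=> F mF; have := key F mF; rewrite -keyT => -[+ _].
  by rewrite mulr0 subr0.
have ws (f : R -> R) : measurable_fun setT f -> (forall x : R, `|f x| <= 1) ->
  \int[P]_w (\1_(A j.+1 E) w * sin (W j w) * f (q (X i0 w))) =
  \int[P]_w (\1_(A j.+1 E) w * sin (W j w)) * \int[P]_w f (q (X i0 w)).
  move=> mf f1; apply: (@Rintegral_weight _ _ _ P _ _ (X i0) _ (f \o q) 1) => //.
  - apply: measurable_funM => //; exact: measurable_sinW.
  - apply: measurableT_comp => //; exact: mphi.
  - by move=> x; rewrite normrM mulr_ile1// sin_norm1.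
  - by move=> y; exact: f1.
  move=> F mF; have := key F mF; rewrite -keyT => -[_ +].
  by rewrite mulr0 add0r.
have mcos : measurable_fun setT (cos : R -> R).
  by apply: continuous_measurable_fun; exact: continuous_cos.
have msin : measurable_fun setT (sin : R -> R).
  by apply: continuous_measurable_fun; exact: continuous_sin.
have mq : measurable_fun setT (fun w => q (X i0 w)).
  by apply: measurableT_comp => //; exact: mphi.
have iI (f g : T -> R) : measurable_fun setT f -> (forall x, `|f x| <= 1) ->
    measurable_fun setT g -> (forall x, `|g x| <= 1) ->
    P.-integrable setT (EFin \o (fun w => \1_(A j.+1 E) w * f w * g w)).
  move=> mf f1 mg g1; apply: (@bounded_integrable _ _ _ P _ 1).
    apply: measurable_funM => //; apply: measurable_funM => //.
  by move=> x; rewrite !normrM; do !apply: mulr_ile1 => //; rewrite mulr_ge0.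
have mcW := measurable_cosW (mW j); have msW := measurable_sinW (mW j).
have mcq := measurable_cosW mq; have msq := measurable_sinW mq.
have c1 w := cos_norm1 (W j w); have s1 w := sin_norm1 (W j w).
have cq1 w := cos_norm1 (q (X i0 w)); have sq1 w := sin_norm1 (q (X i0 w)).
rewrite zS mulrAC -keyT charfE.
have -> : \int[P]_w (\1_(A j.+1 E) w * cos (W j.+1 w)) =
    \int[P]_w (\1_(A j.+1 E) w * cos (W j w) * cos (q (X i0 w))) -
    \int[P]_w (\1_(A j.+1 E) w * sin (W j w) * sin (q (X i0 w))).
  have /= <- := RintegralB measurableT (iI _ _ mcW c1 mcq cq1) (iI _ _ msW s1 msq sq1).
  by apply: eq_Rintegral => w _; rewrite WS cosD mulrBr !mulrA.
have -> : \int[P]_w (\1_(A j.+1 E) w * sin (W j.+1 w)) =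
    \int[P]_w (\1_(A j.+1 E) w * cos (W j w) * sin (q (X i0 w))) +
    \int[P]_w (\1_(A j.+1 E) w * sin (W j w) * cos (q (X i0 w))).
  have /= <- := RintegralD measurableT (iI _ _ mcW c1 msq sq1) (iI _ _ msW s1 mcq cq1).
  by apply: eq_Rintegral => w _; rewrite WS sinD mulrDr !mulrA addrC.
rewrite (wc _ mcos cos_norm1) (wc _ msin sin_norm1).
rewrite (ws _ mcos cos_norm1) (ws _ msin sin_norm1).
by apply/eqP; rewrite eq_complex /= eqxx /= addrC.
Qed.

Lemma charf_independent_sum :
  charf (fun w => \sum_(i < n) phi i (X i w)) =
  \prod_(i < n) charf (fun w => phi i (X i w)).
Proof.
have := @integral_indic_independent_sum n (leqnn _) (fun=> setT) (fun=> measurableT).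
have -> : A n (fun=> setT) = setT by rewrite /A; apply/seteqP; split.
have WE w : W n w = \sum_(i < n) phi i (X i w).
  by rewrite /W; apply: eq_bigl => i; rewrite ltn_ord.
rewrite probability_setT mulr1 => H.
transitivity (\prod_(i < n | (i < n)%N) charf (fun w => phi i (X i w))); last first.
  by apply: eq_bigl => i; rewrite ltn_ord.
rewrite -H charfE; congr (_ +i* _); apply: eq_Rintegral => w _;
  by rewrite indicT mul1r WE.
Qed.

End independent_sum.
End characteristic_functions.

(** * The functional [E (1 - cos W)] *)

Section trigonometric_bounds.
Context {R : realType}.
Implicit Types x y : R.

(** The mean value theorem from 0. The bound on the intermediate point [c] allows an estimate of
    [df] near 0 to be fed back, which produces the quadratic bounds below from the linear ones. *)
Let lip (f df : R -> R) : (forall x, is_derive x 1 f (df x)) ->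
  forall x, exists2 c, `|c| <= `|x| & f x - f 0 = df c * x.
Proof.
move=> fdf x.
have cf : continuous f.
  by move=> y; apply/differentiable_continuous/derivable1_diffP; have [] := fdf y.
have [x0|x0|->] := ltrgtP x 0; last first.
- by exists 0 => //; rewrite subrr mulr0.
- have [c] := MVT x0 (fun y _ => fdf y) (continuous_subspaceT cf).
  rewrite in_itv/= => /andP[c0 cx]; rewrite subr0 => ->; exists c => //.
  by rewrite !gtr0_norm// ltW.
- have [c] := MVT x0 (fun y _ => fdf y) (continuous_subspaceT cf).
  rewrite in_itv/= => /andP[xc c0] E; exists c.
    by rewrite !ltr0_norm// lerN2 ltW.
  by rewrite -opprB E sub0r mulrN opprK.
Qed.

Lemma norm_sin_le x : `|sin x| <= `|x|.
Proof.
have [c _] := @lip sin cos (@is_derive_sin R) x.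
rewrite sin0 subr0 => ->.
by rewrite normrM ler_piMl// ler_norml cos_geN1 cos_le1.
Qed.

Lemma cos_defect_le x : 1 - cos x <= `|x|.
Proof.
have [c _] := @lip cos (fun x => - sin x) (@is_derive_cos R) x.
rewrite cos0 => /(congr1 -%R); rewrite opprB => ->.
rewrite mulNr opprK (le_trans (ler_norm _))// normrM ler_piMl//.
by rewrite ler_norml sin_geN1 sin_le1.
Qed.

Lemma cos_defect_le_sqr x : 1 - cos x <= x ^+ 2.
Proof.
have [c cx] := @lip cos (fun x => - sin x) (@is_derive_cos R) x.
rewrite cos0 => /(congr1 -%R); rewrite opprB => ->.
rewrite mulNr opprK (le_trans (ler_norm _))// normrM -[leRHS]real_normK ?num_real//.
by rewrite expr2 ler_wpM2r// (le_trans (norm_sin_le _)).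
Qed.

Lemma norm_sin_sub_le_sqr x : `|sin x - x| <= x ^+ 2.
Proof.
have dsub y : is_derive y 1 (sin - id : R -> R) (cos y - 1).
  exact: is_deriveB.
have [c cx] := @lip (fun x => sin x - x) (fun x => cos x - 1) dsub x.
rewrite sin0 !subr0 => ->; rewrite normrM -[leRHS]real_normK ?num_real// expr2.
rewrite ler_wpM2r// distrC (@ger0_norm _ (1 - cos c)) ?subr_ge0 ?cos_le1//.
exact: le_trans (cos_defect_le _) cx.
Qed.

(** Since 2 (1 - cos x) = |e^(ix) - 1|^2, this is |a + b|^2 <= 2 (|a|^2 + |b|^2) for a = e^(ix) - 1
    and b = 1 - e^(-iy). The two squares in the proof add up to |a - b|^2. *)
Lemma cos_defectD x y :
  1 - cos (x + y) <= 2 * ((1 - cos x) + (1 - cos y)).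
Proof.
rewrite cosD.
have := sqr_ge0 (cos x + cos y - 2); have := sqr_ge0 (sin x - sin y).
have := cos2Dsin2 x; have := cos2Dsin2 y; rewrite !expr2; nra.
Qed.

(** For points (a, s) and (b, t) of the unit circle, 2 g is their squared distance, so |a - b|^2 <=
    2 g <= (de + g / de)^2. Unlike the root of 2 g, the bound [de + g / de] is affine in [g] and can
    be integrated term by term; [de] is chosen later. *)
Let distb (a b s t g de : R) : 0 < de -> a ^+ 2 + s ^+ 2 = 1 -> b ^+ 2 + t ^+ 2 = 1 ->
  g = 1 - (a * b + s * t) -> `|a - b| <= de + g / de.
Proof.
move=> de0 a1 b1 gE.
have g0 : 0 <= g.
  have := sqr_ge0 (a - b); have := sqr_ge0 (s - t).
  by move: a1 b1; rewrite gE !expr2; nra.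
have gde : 0 <= g / de by rewrite divr_ge0// ltW.
have : (a - b) ^+ 2 <= (de + g / de) ^+ 2.
  have -> : (de + g / de) ^+ 2 = de ^+ 2 + 2 * g + (g / de) ^+ 2.
    by field; rewrite gt_eqF.
  have := sqr_ge0 de; have := sqr_ge0 (g / de); have := sqr_ge0 (s - t).
  by move: a1 b1; rewrite gE !expr2; nra.
by rewrite -ler_sqrt ?sqr_ge0// !sqrtr_sqr [X in _ <= X]ger0_norm// addr_ge0// ltW.
Qed.

Lemma norm_cosB_le x y de : 0 < de ->
  `|cos x - cos y| <= de + (1 - cos (x - y)) / de.
Proof.
by move=> de0; apply: (distb de0 (cos2Dsin2 x) (cos2Dsin2 y)); rewrite cosB.
Qed.

Lemma norm_sinB_le x y de : 0 < de ->
  `|sin x - sin y| <= de + (1 - cos (x - y)) / de.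
Proof.
move=> de0; have sc (z : R) : sin z ^+ 2 + cos z ^+ 2 = 1 by rewrite addrC cos2Dsin2.
by apply: (distb de0 (sc x) (sc y)); rewrite cosB [cos x * _ + _]addrC.
Qed.

Lemma expR_cos_defect_le x y a b : x <= 0 -> `|x| <= a -> `|y| <= b ->
  1 - expR x * cos y <= a + b.
Proof.
move=> x0; rewrite ler0_norm// => xa yb.
have ex : expR x <= 1 by rewrite expR_le1.
have ex1 := expR_ge1Dx x; have cy := cos_defect_le y.
have : expR x * (1 - cos y) <= 1 - cos y by rewrite ler_piMl// subr_ge0 cos_le1.
by rewrite mulrBr mulr1; lra.
Qed.

End trigonometric_bounds.

Section cosine_defect.
Context {R : realType} d (T : measurableType d) (P : probability T R).
Local Open Scope complex_scope.
Implicit Types U V W : T -> R.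

(* Twice [cosdef W] is the squared L^2-distance of [exp (i W)] to 1. *)
Definition cosdef W : R := \int[P]_w (1 - cos (W w)).

Let icst (r : R) : P.-integrable setT (EFin \o cst r).
Proof. by apply: (@bounded_integrable _ _ _ P _ `|r|); first exact: measurable_cst. Qed.

Let iJ W : measurable_fun setT W ->
  P.-integrable setT (EFin \o (fun w => 1 - cos (W w))).
Proof. by move=> mW; exact: (integrableB measurableT (icst 1) (integrable_cos P mW)). Qed.

Lemma cosdefE W : measurable_fun setT W ->
  cosdef W = 1 - complex.Re (charf P W).
Proof.
move=> mW; rewrite /cosdef charfE /= -[X in _ = X - _](Rintegral_cst1 P).
by have /= -> := RintegralB measurableT (icst 1) (integrable_cos P mW).
Qed.

Lemma cosdef_ge0 W : 0 <= cosdef W.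
Proof. by apply: Rintegral_ge0 => w _; rewrite subr_ge0 cos_le1. Qed.

Lemma cosdefN W : cosdef (fun w => - W w) = cosdef W.
Proof. by apply: eq_Rintegral => w _; rewrite cosN. Qed.

Lemma eq_cosdef V W : V =1 W -> cosdef V = cosdef W.
Proof. by move=> VW; apply: eq_Rintegral => w _; rewrite VW. Qed.

Lemma cosdefBC V W : cosdef (fun w => V w - W w) = cosdef (fun w => W w - V w).
Proof. by rewrite -cosdefN; apply: eq_cosdef => w; rewrite opprB. Qed.

Lemma ae_eq_charf V W : measurable_fun setT V -> measurable_fun setT W ->
  {ae P, forall w, V w = W w} -> charf P V = charf P W.
Proof.
move=> mV mW VW; rewrite !charfE; congr (_ +i* _); congr fine;
  apply: ae_eq_integral => //; try (apply/measurable_EFinP;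
    solve [exact: measurable_cosW | exact: measurable_sinW]).
- by apply: filterS VW => w + _ => ->.
- by apply: filterS VW => w + _ => ->.
Qed.

Lemma cosdefD V W : measurable_fun setT V -> measurable_fun setT W ->
  cosdef (fun w => V w + W w) <= 2 * (cosdef V + cosdef W).
Proof.
move=> mV mW; rewrite /cosdef.
have /= <- := RintegralD measurableT (iJ mV) (iJ mW).
have /= <- := RintegralZl 2 measurableT (RintegrableD (iJ mV) (iJ mW)).
apply: le_Rintegral => //.
- by apply: iJ; exact: measurable_funD.
- exact: (RintegrableZ 2 (RintegrableD (iJ mV) (iJ mW))).
- by move=> w _; exact: cos_defectD.
Qed.

Lemma cosdef_triangle U V W : measurable_fun setT U -> measurable_fun setT V ->
  measurable_fun setT W ->
  cosdef (fun w => U w - W w) <=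
  2 * (cosdef (fun w => U w - V w) + cosdef (fun w => V w - W w)).
Proof.
move=> mU mV mW; rewrite (@eq_cosdef _ (fun w => (U w - V w) + (V w - W w))).
  by apply: cosdefD; exact: measurable_funB.
by move=> w; rewrite addrA subrK.
Qed.

Lemma norm_ReB_charf V W de : measurable_fun setT V -> measurable_fun setT W ->
  0 < de -> `|complex.Re (charf P V) - complex.Re (charf P W)| <=
            de + cosdef (fun w => V w - W w) / de.
Proof.
move=> mV mW de0; have mVW : measurable_fun setT (fun w => V w - W w).
  exact: measurable_funB.
rewrite !charfE /=.
have /= <- := RintegralB measurableT (integrable_cos P mV) (integrable_cos P mW).
have iB := integrableB measurableT (integrable_cos P mV) (integrable_cos P mW).
rewrite (le_trans (le_normr_Rintegral _ iB))//.
have iJde := RintegrableZ de^-1 (iJ mVW).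
rewrite -[X in _ <= X + _](Rintegral_cst1 P) [X in _ <= _ + X]mulrC /cosdef.
have /= <- := RintegralZl de^-1 measurableT (iJ mVW).
have /= <- := RintegralD measurableT (icst de) iJde.
apply: le_Rintegral => //.
- exact: (integrable_norm iB).
- exact: (RintegrableD (icst de) iJde).
- by move=> w _ /=; rewrite [X in _ <= _ + X]mulrC; exact: norm_cosB_le.
Qed.

Lemma norm_ImB_charf V W de : measurable_fun setT V -> measurable_fun setT W ->
  0 < de -> `|complex.Im (charf P V) - complex.Im (charf P W)| <=
            de + cosdef (fun w => V w - W w) / de.
Proof.
move=> mV mW de0; have mVW : measurable_fun setT (fun w => V w - W w).
  exact: measurable_funB.
rewrite !charfE /=.
have /= <- := RintegralB measurableT (integrable_sin P mV) (integrable_sin P mW).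
have iB := integrableB measurableT (integrable_sin P mV) (integrable_sin P mW).
rewrite (le_trans (le_normr_Rintegral _ iB))//.
have iJde := RintegrableZ de^-1 (iJ mVW).
rewrite -[X in _ <= X + _](Rintegral_cst1 P) [X in _ <= _ + X]mulrC /cosdef.
have /= <- := RintegralZl de^-1 measurableT (iJ mVW).
have /= <- := RintegralD measurableT (icst de) iJde.
apply: le_Rintegral => //.
- exact: (integrable_norm iB).
- exact: (RintegrableD (icst de) iJde).
- by move=> w _ /=; rewrite [X in _ <= _ + X]mulrC; exact: norm_sinB_le.
Qed.

(** Below the threshold 1 - cos W is at most |W|, above it at most 2. Through this bound convergence
    in probability enters the argument. *)
Lemma cosdef_le_probability W e : measurable_fun setT W -> 0 < e ->
  cosdef W <= e + 2 * fine (P [set w | e <= `|W w|]).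
Proof.
move=> mW e0; set E := [set w | _].
have mE : measurable E.
  have mN : measurable_fun setT (fun w => `|W w|) by exact: measurableT_comp.
  rewrite (_ : E = (fun w => `|W w|) @^-1` `[e, +oo[%classic); last first.
    by apply/seteqP; split => w; rewrite /E /= in_itv/= andbT.
  by rewrite -[X in measurable X]setTI; exact: mN.
have iE : P.-integrable setT (EFin \o (\1_E : T -> R)).
  apply: (@bounded_integrable _ _ _ P _ 1); first exact: measurable_indic.
  by move=> x; rewrite ger0_norm// indicE; case: (_ \in _).
have -> : fine (P E) = \int[P]_w \1_E w.
  by rewrite /Rintegral integral_indic ?setIT.
rewrite -[X in _ <= X + _](Rintegral_cst1 P).
have /= <- := RintegralZl 2 measurableT iE.
have /= <- := RintegralD measurableT (icst e) (RintegrableZ 2 iE).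
apply: le_Rintegral => //; first exact: iJ.
  exact: (RintegrableD (icst e) (RintegrableZ 2 iE)).
move=> w _; rewrite indicE; have [|/negP wE] := boolP (w \in E).
  by rewrite mulr1 => _; have := cos_geN1 (W w); lra.
rewrite mulr0 addr0 (le_trans (cos_defect_le _))// ltW// ltNge.
by apply/negP => eW; apply: wE; rewrite inE.
Qed.

End cosine_defect.

Section complex_l1_norm.
Context {R : realType}.
Implicit Types z w : R[i].

(** A norm with real values, whereas the norm of [R[i]] has values in [R[i]]. Bounds on real and
    imaginary parts simply add up, and it is submultiplicative. *)
Definition cnorm1 z : R := `|complex.Re z| + `|complex.Im z|.

Lemma cnorm1D z w : cnorm1 (z + w) <= cnorm1 z + cnorm1 w.
Proof.
case: z => a b; case: w => c e; rewrite /cnorm1 /=.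
by rewrite addrACA lerD// ler_normD.
Qed.

Lemma cnorm1M z w : cnorm1 (z * w) <= cnorm1 z * cnorm1 w.
Proof.
case: z => a b; case: w => c e; rewrite /cnorm1 /=.
have := ler_normB (a * c) (b * e); have := ler_normD (a * e) (b * c).
by rewrite !normrM; lra.
Qed.

Lemma cnorm1_ge0 z : 0 <= cnorm1 z.
Proof. by rewrite addr_ge0. Qed.

Lemma cvg_cnorm1 (u : nat -> R[i]) (c : R[i]) :
  (forall e : R, 0 < e -> exists N, forall n, (N <= n)%N -> cnorm1 (u n - c) <= e) ->
  (u : nat -> R[i]^o) @ \oo --> (c : R[i]^o).
Proof.
move=> H; apply/cvgrPdist_le => e e0.
(* The radius [e] is an element of [R[i]]; being positive, it has imaginary part 0. *)
have er : 0 < complex.Re e by move: e0; case: e => a b; rewrite ltcE /= => /andP[].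
have [N HN] := H _ er; exists N => // n /= Nn.
rewrite distrC; apply: (@le_trans _ _ (cnorm1 (u n - c))%:C%C).
  rewrite /cnorm1; case: (u n - c) => a b /=.
  rewrite normc_def /= lecR; apply: (@le_trans _ _ (Num.sqrt ((`|a| + `|b|) ^+ 2))).
    rewrite ler_wsqrtr// -(real_normK (num_real a)) -(real_normK (num_real b)).
    by rewrite sqrrD lerD2r lerDl mulrn_wge0// mulr_ge0.
  by rewrite sqrtr_sqr ger0_norm// addr_ge0.
have -> : e = (complex.Re e)%:C%C.
  by move: e0; case: e {er HN} => a b; rewrite ltcE /= => /andP[/eqP -> _].
by rewrite lecR; exact: HN.
Qed.

Lemma cnorm1_charf d (T : measurableType d) (P : probability T R) (W : T -> R) :
  measurable_fun setT W -> cnorm1 (charf P W) <= 2.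
Proof.
move=> mW; rewrite /cnorm1 charfE /=.
have b1 (g : R -> R) : (forall x, `|g x| <= 1) ->
    P.-integrable setT (EFin \o (fun x => g (W x))) -> `|\int[P]_x g (W x)| <= 1.
  move=> g1 ig; apply: le_trans (le_normr_Rintegral measurableT ig) _.
  rewrite -[leRHS](Rintegral_cst1 P); apply: le_Rintegral => //.
  - exact: (integrable_norm ig).
  - apply: (@bounded_integrable _ _ _ P _ 1); first exact: measurable_cst.
    by move=> x; rewrite normr1.
by have := b1 _ (@cos_norm1 R) (integrable_cos P mW);
  have := b1 _ (@sin_norm1 R) (integrable_sin P mW); lra.
Qed.

(** If the defect is of order [de ^+ 2], then [de + cosdef / de] is of order [de]; the factor 2
    accounts for the real and the imaginary part. *)
Lemma cnorm1_charfB d (T : measurableType d) (P : probability T R)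
    (V W : T -> R) (de c : R) :
  measurable_fun setT V -> measurable_fun setT W -> 0 < de ->
  cosdef P (fun x => V x - W x) <= c * de ^+ 2 ->
  cnorm1 (charf P V - charf P W) <= 2 * (1 + c) * de.
Proof.
move=> mV mW de0 VW.
have := norm_ReB_charf P mV mW de0; have := norm_ImB_charf P mV mW de0.
have : cosdef P (fun x => V x - W x) / de <= c * de.
  by rewrite ler_pdivrMr// -mulrA -expr2.
rewrite /cnorm1; case: (charf P V) (charf P W) => a b [a' b'] /=; lra.
Qed.

End complex_l1_norm.

(** * The cumulant transform *)

Section dot_product.
Context {R : realType}.

Lemma dotp_suml n (I : Type) (s : seq I) (p : pred I) (x : I -> 'cV[R]_n) y :
  dotp (\sum_(i <- s | p i) x i) y = \sum_(i <- s | p i) dotp (x i) y.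
Proof.
rewrite /dotp exchange_big/=; apply: eq_bigr => j _.
by rewrite summxE mulr_suml.
Qed.

Lemma dotp_sumr n (I : Type) (s : seq I) (p : pred I) (x : I -> 'cV[R]_n) y :
  dotp y (\sum_(i <- s | p i) x i) = \sum_(i <- s | p i) dotp y (x i).
Proof.
rewrite /dotp exchange_big/=; apply: eq_bigr => j _.
by rewrite summxE mulr_sumr.
Qed.

Lemma dotpNl n (x y : 'cV[R]_n) : dotp (- x) y = - dotp x y.
Proof. by rewrite /dotp -sumrN; apply: eq_bigr => i _; rewrite mxE mulNr. Qed.

Lemma measurable_dotp n (x : 'cV[R]_n) : measurable_fun setT (dotp x).
Proof.
apply: measurable_sum => i; apply: measurable_funM => //.
exact: measurable_coord.
Qed.

Lemma dotp_mulmx m n (x : 'cV[R]_m) (A : 'M[R]_(m, n)) (y : 'cV[R]_n) :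
  dotp x (A *m y) = dotp (A^T *m x) y.
Proof.
rewrite /dotp; under eq_bigr do rewrite mxE mulr_sumr.
rewrite exchange_big/=; apply: eq_bigr => j _; rewrite mxE mulr_suml.
by apply: eq_bigr => i _; rewrite mxE; ring.
Qed.

Definition norm1 n (x : 'cV[R]_n) : R := \sum_(i < n) `|x i 0|.

Lemma norm1_ge0 n (x : 'cV[R]_n) : 0 <= norm1 x.
Proof. exact: sumr_ge0. Qed.

Lemma norm_coord_le n (x : 'cV[R]_n) i : `|x i 0| <= norm1 x.
Proof. by rewrite /norm1 (bigD1 i)//= lerDl sumr_ge0. Qed.

Lemma norm_dotp_le n (x y : 'cV[R]_n) : `|dotp x y| <= norm1 x * norm1 y.
Proof.
rewrite (le_trans (ler_norm_sum _ _ _))// mulr_suml ler_sum// => i _.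
by rewrite normrM ler_wpM2l// norm_coord_le.
Qed.

Lemma norm_coord_le_enorm n (x : 'cV[R]_n) i : `|x i 0| <= enorm x.
Proof.
rewrite -sqrtr_sqr ler_sqrt.
  by rewrite /dotp (bigD1 i)//= expr2 lerDl sumr_ge0// => j _; rewrite -expr2 sqr_ge0.
by rewrite /dotp sumr_ge0// => j _; rewrite -expr2 sqr_ge0.
Qed.

Lemma norm_dotp_le_enorm n (x y : 'cV[R]_n) : `|dotp x y| <= norm1 x * enorm y.
Proof.
rewrite (le_trans (ler_norm_sum _ _ _))// mulr_suml ler_sum// => i _.
by rewrite normrM ler_wpM2l// norm_coord_le_enorm.
Qed.

Lemma norm1_mulmx_le m n (A : 'M[R]_(m, n)) (x : 'cV[R]_n) :
  norm1 (A *m x) <= (\sum_i \sum_j `|A i j|) * norm1 x.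
Proof.
rewrite /norm1 mulr_suml ler_sum// => i _; rewrite mxE.
rewrite (le_trans (ler_norm_sum _ _ _))// mulr_suml ler_sum// => j _.
by rewrite normrM ler_wpM2l// norm_coord_le.
Qed.

Lemma cvg_norm1 n (x : nat -> 'cV[R]_n) : x @ \oo --> (0 : 'cV[R]_n) ->
  (fun k => norm1 (x k)) @ \oo --> (0 : R).
Proof.
move=> x0; have -> : (0 : R) = \sum_(i < n) 0 by rewrite big1.
apply: cvg_big => [|i _]; first exact: add_continuous.
have : (fun k => x k i 0) @ \oo --> (0 : R).
  have -> : 0 = (0 : 'cV[R]_n) i 0 by rewrite mxE.
  exact: (cvg_comp _ (fun M : 'cV[R]_n => M i 0) x0 (@coord_continuous _ _ _ i 0 0)).
by move=> /cvg_norm; rewrite normr0.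
Qed.

Lemma norm1_le_norm n (x : 'cV[R]_n) : norm1 x <= n%:R * `|x|.
Proof.
rewrite /norm1 -[n in n%:R]card_ord mulr_natl -sumr_const ler_sum// => i _.
rewrite {2}/Num.norm/= mx_normrE.
exact: (le_bigmax _ (fun ij : 'I_n * 'I_1 => `|x ij.1 ij.2|) (i, 0)).
Qed.

End dot_product.

Section cumulant_bounds.
Context {R : realType} (d : nat) (gamma : 'cV[R]_d) (Sigma : 'M[R]_d)
  (Q : {measure set 'cV[R]_d -> \bar R}).
Hypothesis tri : characteristic_triplet gamma Sigma Q.
Local Notation psi := (cumulant gamma Sigma Q).
Implicit Types theta x : 'cV[R]_d.

Let cut (x : 'cV[R]_d) : R := \1_`[0, 1]%classic (enorm x).
Let gre (theta x : 'cV[R]_d) : R := cos (dotp theta x) - 1.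
Let gim (theta x : 'cV[R]_d) : R :=
  sin (dotp theta x) - dotp theta x * cut x.

Let integrandE theta x :
  (expCi (dotp theta x) - 1 -
    'i%C * (dotp theta x * \1_`[0, 1]%classic (enorm x))%:C =
  gre theta x +i* gim theta x)%C.
Proof.
rewrite expCiE; apply/eqP; rewrite eq_complex /= !(mul0r, mul1r, mulr0).
by rewrite subrr !oppr0 !addr0 add0r !eqxx.
Qed.

Let cumulantE theta : psi theta =
  ((- (2^-1 * dotp theta (Sigma *m theta)) + \int[Q]_x gre theta x) +i*
   (dotp gamma theta + \int[Q]_x gim theta x))%C.
Proof.
rewrite /cumulant; set I := integralC _ _.
have -> : I = (\int[Q]_x gre theta x +i* \int[Q]_x gim theta x)%C.
  by rewrite /I /integralC; congr (_ +i* _)%C; apply: eq_Rintegral => x _;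
    rewrite integrandE.
apply/eqP; rewrite eq_complex /= !(mul0r, mul1r, mulr0).
by rewrite subrr !add0r oppr0 addr0 !eqxx.
Qed.

Lemma Re_cumulant theta : complex.Re (psi theta) =
  - (2^-1 * dotp theta (Sigma *m theta)) + \int[Q]_x gre theta x.
Proof. by rewrite cumulantE. Qed.

Lemma Im_cumulant theta : complex.Im (psi theta) =
  dotp gamma theta + \int[Q]_x gim theta x.
Proof. by rewrite cumulantE. Qed.

Let h (x : 'cV[R]_d) : R := Num.min 1 (enorm x ^+ 2).

Let menorm : measurable_fun setT (@enorm R d).
Proof.
apply: (@measurableT_comp _ _ _ _ _ _ (Num.sqrt : R -> R)).
  by apply: continuous_measurable_fun; exact: sqrt_continuous.
apply: measurable_sum => i; apply: measurable_funM => //; exact: measurable_coord.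
Qed.

Let mcut : measurable_fun setT cut.
Proof. by apply: measurableT_comp menorm; exact: measurable_indic. Qed.

Let mh : measurable_fun setT h.
Proof. by apply: measurable_minr => //; exact: measurable_funX. Qed.

Let h0 x : 0 <= h x.
Proof. by rewrite le_min ler01 sqr_ge0. Qed.

Let ih : Q.-integrable setT (EFin \o h).
Proof.
have [_ _ [_ hoo]] := tri; apply/integrableP; split; first exact/measurable_EFinP.
rewrite (le_lt_trans _ hoo)//; apply: ge0_le_integral => //=.
- by apply/measurable_EFinP; exact: measurableT_comp.
- exact/measurable_EFinP.
- by move=> x _; rewrite lee_fin ger0_norm.
Qed.

Let mgre theta : measurable_fun setT (gre theta).
Proof.
apply: measurable_funB => //; apply: measurableT_comp (measurable_dotp theta).
by apply: continuous_measurable_fun; exact: continuous_cos.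
Qed.

Let mgim theta : measurable_fun setT (gim theta).
Proof.
apply: measurable_funB; last by apply: measurable_funM => //; exact: measurable_dotp.
apply: measurableT_comp (measurable_dotp theta).
by apply: continuous_measurable_fun; exact: continuous_sin.
Qed.

Let sqr_dotp theta x : dotp theta x ^+ 2 <= norm1 theta ^+ 2 * enorm x ^+ 2.
Proof.
rewrite -exprMn -[leLHS]real_normK ?num_real// lerXn2r ?nnegrE//.
  by rewrite mulr_ge0 ?norm1_ge0 ?sqrtr_ge0.
exact: norm_dotp_le_enorm.
Qed.

(** Where [enorm x] is at least 1, [h x = 1] and the trivial bound 2 suffices; elsewhere [h x] is
    the square of [enorm x] and the quadratic estimate applies. For [norm1 theta <= 1] the constant
    is at most 3. *)
Let gre_le theta x : `|gre theta x| <= (2 + norm1 theta ^+ 2) * h x.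
Proof.
rewrite /gre distrC ger0_norm ?subr_ge0 ?cos_le1// /h.
have [x1|x1] := leP 1 (enorm x ^+ 2).
  by have := cos_geN1 (dotp theta x); have := sqr_ge0 (norm1 theta); lra.
rewrite (le_trans (cos_defect_le_sqr _))// (le_trans (sqr_dotp _ _))//.
by rewrite ler_wpM2r ?sqr_ge0// lerDr.
Qed.

(** Same split as for [gre]: the cut-off subtracts the linear term exactly on the unit ball, where
    sin u - u is bounded by u^2, and leaves a bare sine outside it. *)
Let gim_le theta x : `|gim theta x| <= (2 + norm1 theta ^+ 2) * h x.
Proof.
rewrite /gim /h /cut indicE mem_setE in_itv/= sqrtr_ge0/=.
have s0 := sqr_ge0 (norm1 theta).
have [x1|x1] := leP (enorm x) 1.
  rewrite mulr1 (le_trans (norm_sin_sub_le_sqr _))// (le_trans (sqr_dotp _ _))//.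
  have xx : enorm x ^+ 2 <= 1 by rewrite expr_le1 ?sqrtr_ge0.
  by rewrite min_r// ler_wpM2r ?sqr_ge0// lerDr.
have xx : 1 <= enorm x ^+ 2 by rewrite expr_ge1 ?sqrtr_ge0 ?ltW.
rewrite mulr0 subr0 min_l// mulr1.
by have := sin_norm1 (dotp theta x); lra.
Qed.

Let ig (g : 'cV[R]_d -> 'cV[R]_d -> R) theta : measurable_fun setT (g theta) ->
  (forall x, `|g theta x| <= (2 + norm1 theta ^+ 2) * h x) ->
  Q.-integrable setT (EFin \o g theta).
Proof.
move=> mg gh; apply: (le_integrable measurableT _ _ (RintegrableZ (2 + norm1 theta ^+ 2) ih)).
  exact/measurable_EFinP.
move=> x _; rewrite /= lee_fin (le_trans (gh x))//.
by rewrite ler_norm.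
Qed.

Let igre theta : Q.-integrable setT (EFin \o gre theta).
Proof. exact: (@ig gre theta (mgre theta) (gre_le theta)). Qed.

Let igim theta : Q.-integrable setT (EFin \o gim theta).
Proof. exact: (@ig gim theta (mgim theta) (gim_le theta)). Qed.

Lemma Re_cumulant_le0 theta : complex.Re (psi theta) <= 0.
Proof.
have [_ pos _] := tri; rewrite Re_cumulant.
have : \int[Q]_x gre theta x <= \int[Q]_x 0.
  apply: le_Rintegral => //.
    by have := RintegrableZ 0 ih; apply: eq_integrable => // x _; rewrite /= mul0r.
  by move=> x _; rewrite subr_le0 cos_le1.
rewrite Rintegral_cst// mul0r; have := pos theta; lra.
Qed.

Lemma cumulant0 : psi 0 = 0.
Proof.
have d0 x : dotp 0 x = 0 :> R.
  by rewrite /dotp big1// => i _; rewrite mxE mul0r.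
have dr0 x : dotp x 0 = 0 :> R.
  by rewrite /dotp big1// => i _; rewrite mxE mulr0.
apply/eqP; rewrite eq_complex Re_cumulant Im_cumulant d0 dr0 mulr0 oppr0 !add0r /=.
rewrite /gre /gim; apply/andP; split; apply/eqP.
  rewrite -[RHS](mul0r (fine (Q setT))) -Rintegral_cst//.
  by apply: eq_Rintegral => x _; rewrite d0 cos0 subrr.
rewrite -[RHS](mul0r (fine (Q setT))) -Rintegral_cst//.
by apply: eq_Rintegral => x _; rewrite d0 sin0 mul0r subrr.
Qed.

Let quad_le theta : `|dotp theta (Sigma *m theta)| <=
  norm1 theta * ((\sum_i \sum_j `|Sigma i j|) * norm1 theta).
Proof.
rewrite (le_trans (norm_dotp_le _ _))// ler_wpM2l ?norm1_ge0//.
exact: norm1_mulmx_le.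
Qed.

Lemma cumulant_bounded : exists M : R, forall theta, norm1 theta <= 1 ->
  `|complex.Re (psi theta)| <= M /\ `|complex.Im (psi theta)| <= M.
Proof.
pose H := \int[Q]_x h x; pose C := \sum_i \sum_j `|Sigma i j|.
have C0 : 0 <= C by rewrite sumr_ge0// => i _; rewrite sumr_ge0.
have g0 := norm1_ge0 gamma.
have H0 : 0 <= H by exact: Rintegral_ge0.
exists (C + norm1 gamma + 3 * H) => theta t1.
have t0 := norm1_ge0 theta.
have gH (g : 'cV[R]_d -> 'cV[R]_d -> R) : Q.-integrable setT (EFin \o g theta) ->
  (forall x, `|g theta x| <= (2 + norm1 theta ^+ 2) * h x) ->
  `|\int[Q]_x g theta x| <= 3 * H.
  move=> iG gh; rewrite (le_trans (le_normr_Rintegral _ iG))//.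
  have /= <- := RintegralZl 3 measurableT ih.
  apply: le_Rintegral => //.
  - exact: (integrable_norm iG).
  - exact: (RintegrableZ 3 ih).
  - move=> x _; rewrite (le_trans (gh x))// ler_wpM2r//.
    have : norm1 theta ^+ 2 <= 1 by rewrite expr_le1.
    lra.
split.
  rewrite Re_cumulant (le_trans (ler_normD _ _))// lerD//; last exact: gH (igre _) (gre_le _).
  rewrite normrN normrM ger0_norm ?invr_ge0//.
  have : `|dotp theta (Sigma *m theta)| <= C.
    rewrite (le_trans (quad_le _))// -/C -[leRHS]mul1r ler_pM ?mulr_ge0//.
    by rewrite ler_piMr.
  lra.
rewrite Im_cumulant (le_trans (ler_normD _ _))// lerD//; last exact: gH (igim _) (gim_le _).
rewrite (le_trans (norm_dotp_le _ _))//.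
have : norm1 gamma * norm1 theta <= norm1 gamma by rewrite ler_piMr.
lra.
Qed.

Let cvg_int (g : 'cV[R]_d -> 'cV[R]_d -> R) (theta : nat -> 'cV[R]_d) :
  (forall theta, measurable_fun setT (g theta)) ->
  (forall theta x, `|g theta x| <= (2 + norm1 theta ^+ 2) * h x) ->
  (forall n, norm1 (theta n) <= 1) ->
  (forall x, (fun n => g (theta n) x) @ \oo --> (0 : R)) ->
  (fun n => \int[Q]_x g (theta n) x) @ \oo --> (0 : R).
Proof.
move=> mg gh t1 g0.
have m1 n : measurable_fun setT (fun x => (g (theta n) x)%:E).
  exact/measurable_EFinP.
have c1 : {ae Q, forall x, setT x -> (fun n => (g (theta n) x)%:E) @ \oo --> 0%E}.
  by apply: aeW => x _; apply/cvg_EFin; [exact: nearW|exact: g0].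
have d1 : {ae Q, forall x n, setT x -> (`|(g (theta n) x)%:E| <= (3 * h x)%:E)%E}.
  apply: aeW => x n _; rewrite /= lee_fin (le_trans (gh _ _))// ler_wpM2r//.
  have : norm1 (theta n) ^+ 2 <= 1 by rewrite expr_le1 ?norm1_ge0.
  lra.
have [_ _] := dominated_convergence measurableT m1 (measurable_cst 0%E) c1
  (RintegrableZ 3 ih) d1.
rewrite integral0 => H.
by have -> : (0 : R) = fine 0%E by []; apply: fine_cvg; exact: H.
Qed.

Lemma cumulant_cvg0 (theta : nat -> 'cV[R]_d) :
  theta @ \oo --> (0 : 'cV[R]_d) ->
  (fun n => complex.Re (psi (theta n))) @ \oo --> (0 : R) /\
  (fun n => complex.Im (psi (theta n))) @ \oo --> (0 : R).
Proof.
move=> /cvg_norm1 t0.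
(* Replacing the finitely many [theta n] outside the unit ball by 0 does not affect the limits, and
   provides an integrable bound valid for every [n]. *)
wlog t1 : theta t0 / forall n, norm1 (theta n) <= 1.
  move=> H; pose tau n := if norm1 (theta n) <= 1 then theta n else 0.
  have tauE : \forall n \near \oo, tau n = theta n.
    have : \forall n \near \oo, `|norm1 (theta n)| < 1 by exact: cvgr0_norm_lt.
    apply: filterS => n n1; rewrite /tau ifT//.
    by rewrite (le_trans (ler_norm _))// ltW.
  have [||Re0 Im0] := H tau.
  - apply: cvg_trans t0; apply: near_eq_cvg.
    by apply: filterS tauE => n ->.
  - move=> n; rewrite /tau; case: ifP => // _.
    by rewrite /norm1 big1// => i _; rewrite mxE normr0.
  - by split; [apply: cvg_trans Re0|apply: cvg_trans Im0]; apply: near_eq_cvg;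
      apply: filterS tauE => n ->.
have dom (u : nat -> R) c : (forall n, `|u n| <= c * norm1 (theta n)) -> u @ \oo --> (0 : R).
  move=> uc; apply: norm_cvg0.
  apply: (@squeeze_cvgr _ _ _ _ (cst 0) (fun n => c * norm1 (theta n))).
  - by apply: nearW => n; rewrite normr_ge0 uc.
  - exact: cvg_cst.
  - by rewrite -[X in _ --> X](mulr0 c); apply: cvgMr.
have d0 x : (fun n => dotp (theta n) x) @ \oo --> (0 : R).
  by apply: (dom _ (norm1 x)) => n; rewrite mulrC norm_dotp_le.
split.
  rewrite (funext (fun n => Re_cumulant (theta n))).
  rewrite -[X in _ --> X]addr0; apply: cvgD.
    apply: (dom _ (\sum_i \sum_j `|Sigma i j|)) => n.
    have C0 : 0 <= \sum_i \sum_j `|Sigma i j|.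
      by rewrite sumr_ge0// => i _; rewrite sumr_ge0.
    rewrite normrN normrM ger0_norm ?invr_ge0//.
    have := quad_le (theta n).
    have : norm1 (theta n) * ((\sum_i \sum_j `|Sigma i j|) * norm1 (theta n)) <=
      (\sum_i \sum_j `|Sigma i j|) * norm1 (theta n).
      by rewrite ler_piMl ?mulr_ge0 ?norm1_ge0.
    have := normr_ge0 (dotp (theta n) (Sigma *m theta n)); lra.
  apply: cvg_int => // x.
  have cc : (fun n => cos (dotp (theta n) x)) @ \oo --> (1 : R).
    by rewrite -cos0; exact: (continuous_cvg _ (@continuous_cos R 0) (d0 x)).
  have c1 : (fun _ : nat => 1 : R) @ \oo --> (1 : R) by exact: cvg_cst.
  by have := cvgB cc c1; rewrite subrr => H; exact: H.
rewrite (funext (fun n => Im_cumulant (theta n))).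
rewrite -[X in _ --> X]addr0; apply: cvgD.
  by apply: (dom _ (norm1 gamma)) => n; exact: norm_dotp_le.
apply: cvg_int => // x.
have cs : (fun n => sin (dotp (theta n) x)) @ \oo --> (0 : R).
  by rewrite -sin0; exact: (continuous_cvg _ (@continuous_sin R 0) (d0 x)).
have cl : (fun n => dotp (theta n) x * cut x) @ \oo --> (0 : R).
  have cc : (fun _ : nat => cut x) @ \oo --> cut x by exact: cvg_cst.
  by have := cvgM (d0 x) cc; rewrite mul0r => H; exact: H.
by have := cvgB cs cl; rewrite subrr => H; exact: H.
Qed.

End cumulant_bounds.

(** * From convergence in probability to the cosine defect *)

Section convergence_in_probability.
Context {R : realType} d (T : measurableType d) (P : probability T R).

Lemma measurable_norm_ge k (V : T -> 'cV[R]_k) (e : R) :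
  measurable_fun setT V -> measurable [set w | e <= `|V w|].
Proof.
move=> mV; rewrite (_ : [set w | _] = V @^-1` (~` [set v : 'cV[R]_k | `|v| < e])).
  rewrite -[X in measurable X]setTI; apply: mV => //; apply: measurableC.
  apply: sub_sigma_algebra.
  apply: (@open_comp _ _ (fun v : 'cV[R]_k => `|v|) [set x | x < e]); last exact: open_lt.
  by move=> v _; exact: norm_continuous.
by apply/seteqP; split => w /=; rewrite leNgt => /negP.
Qed.

Lemma cvg_in_probability_cosdef k (X : nat -> T -> 'cV[R]_k) (Y : T -> 'cV[R]_k)
    (theta : 'cV[R]_k) :
  (forall n, measurable_fun setT (X n)) -> measurable_fun setT Y ->
  cvg_in_probability P X Y ->
  forall e, 0 < e -> exists N, forall n, (N <= n)%N ->
    cosdef P (fun w => dotp theta (X n w) - dotp theta (Y w)) <= e.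
Proof.
move=> mX mY XY e e0.
have mXY n : measurable_fun setT (fun w => X n w - Y w).
  apply/measurable_mxP => i j.
  rewrite (_ : (fun x => _) = (fun x => X n x i j - Y x i j)); last first.
    by apply/funext => x; rewrite !mxE.
  by apply: measurable_funB; [move: (mX n)|move: mY] => /measurable_mxP; exact.
have mdX n : measurable_fun setT (fun w => dotp theta (X n w) - dotp theta (Y w)).
  apply: measurable_funB; apply: measurableT_comp => //; exact: measurable_dotp.
(* |<theta, x>| is at most [norm1 theta * k%:R] times the sup norm of [x], so a deviation of the
   functional by [e / 2] forces one of the vectors by [e / 2 / C]. The summand 1 keeps [C] positive.
   In the end e / 2 + 2 (e / 4) = e. *)
pose C := norm1 theta * k%:R + 1.
have C0 : 0 < C by rewrite ltr_wpDl// mulr_ge0// norm1_ge0.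
have e20 : 0 < e / 2 by rewrite divr_gt0.
have e4 : 0 < e / 4 by rewrite divr_gt0.
have dC : 0 < e / 2 / C by rewrite divr_gt0.
have /fine_cvgP[fin] := XY _ dC.
move=> /cvgr0_norm_le /(_ _ e4)[N1 _ HN1].
exists N1 => n Nn.
have := HN1 n Nn => /=; set p := P _ => pe.
apply: le_trans (cosdef_le_probability P (mdX n) e20) _.
have le_p : fine (P [set w | e / 2 <= `|dotp theta (X n w) - dotp theta (Y w)|]) <= fine p.
  have mD : measurable [set w | e / 2 <= `|dotp theta (X n w) - dotp theta (Y w)|].
    rewrite (_ : [set w | _] = (fun w => dotp theta (X n w) - dotp theta (Y w)) @^-1`
      (~` [set x : R | `|x| < e / 2])); last first.
      by apply/seteqP; split => w /=; rewrite leNgt => /negP.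
    rewrite -[X in measurable X]setTI; apply: mdX => //; apply: measurableC.
    rewrite (_ : [set x | _] = `](- (e / 2)), (e / 2)[%classic); last first.
      by apply/seteqP; split => x /=; rewrite in_itv/= ltr_norml.
    exact: measurable_itv.
  have mE := measurable_norm_ge (e / 2 / C) (mXY n).
  rewrite fine_le ?fin_num_measure//; apply: le_measure; rewrite ?inE//.
  move=> w /= H; rewrite ler_pdivrMr//; apply: le_trans H _.
  have -> : dotp theta (X n w) - dotp theta (Y w) = dotp theta (X n w - Y w).
    rewrite /dotp -sumrB; apply: eq_bigr => i _.
    by rewrite !mxE mulrBr.
  apply: le_trans (norm_dotp_le _ _) _.
  apply: le_trans (ler_wpM2l (norm1_ge0 _) (norm1_le_norm _)) _.
  by rewrite mulrA mulrC ler_wpM2l// /C lerDl.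
have := le_trans (ler_norm _) pe; lra.
Qed.

End convergence_in_probability.

(** * Translation invariance and sliding humps *)

Section translation_invariance.
Context {R : realType}.
Local Open Scope ereal_scope.

(** The pushforward of the product measure agrees with it on measurable rectangles, and the product
    measure is unique with these values. *)
Lemma product_measure_preserving d1 d2 (T1 : measurableType d1)
    (T2 : measurableType d2)
    (m1 : {sigma_finite_measure set T1 -> \bar R})
    (m2 : {sigma_finite_measure set T2 -> \bar R}) (f : T1 -> T1) (g : T2 -> T2) :
  measurable_fun setT f -> measurable_fun setT g ->
  (forall A, measurable A -> m1 (f @^-1` A) = m1 A) ->
  (forall A, measurable A -> m2 (g @^-1` A) = m2 A) ->
  forall A, measurable A ->
    (m1 \x m2) ((fun p => (f p.1, g p.2)) @^-1` A) = (m1 \x m2) A.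
Proof.
move=> mf mg fm gm A mA.
have mfg : measurable_fun setT (fun p : T1 * T2 => (f p.1, g p.2)).
  apply/measurable_fun_pairP; split => /=.
    exact: (measurableT_comp mf measurable_fst).
  exact: (measurableT_comp mg measurable_snd).
pose nu := measure_function_pushforward__canonical__measure_function_Measure
    (m1 \x m2)%E mfg.
apply/esym; apply: (@product_measure_unique _ _ _ _ _ m1 m2 nu) => // B C mB mC.
rewrite /nu /= /pushforward (_ : _ @^-1` _ = (f @^-1` B) `*` (g @^-1` C))//.
have mfB : measurable (f @^-1` B) by rewrite -[X in measurable X]setTI; exact: mf.
have mgC : measurable (g @^-1` C) by rewrite -[X in measurable X]setTI; exact: mg.
rewrite product_measure1E//; congr (_ * _); [exact: fm|exact: gm].
Qed.

Lemma lebesgue_measure_translation (t : R) (A : set R) : measurable A ->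
  lebesgue_measure ((fun x => x - t)%R @^-1` A) = lebesgue_measure A.
Proof.
move=> mA.
have mt : @measurable_fun _ _ (measurableTypeR R) (measurableTypeR R) setT
    (fun x : R => (x - t)%R) by exact: measurable_funB.
pose nu : {measure set (measurableTypeR R) -> \bar R} :=
  measure_function_pushforward__canonical__measure_function_Measure
    (@lebesgue_measure R) mt.
apply/esym; transitivity (nu A); last by [].
apply: (@lebesgue_measure_unique _ nu) => // _ [[a b] _ <-] /=.
rewrite /pushforward (_ : _ @^-1` _ = `](a + t)%R, (b + t)%R]%classic).
  rewrite !lebesgue_measure_itv/= !lte_fin ltrD2r.
  by case: ifP => // _; rewrite -!EFinD; congr EFin; ring.
apply/seteqP; split => x /=; rewrite !in_itv/=; lra.
Qed.

Lemma measurable_translation n (t : 'cV[R]_n) :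
  measurable_fun setT (fun v : 'cV[R]_n => (v - t)%R).
Proof.
apply/measurable_mxP => i j.
rewrite (_ : (fun x => _) = (fun x : 'cV[R]_n => x i j - t i j)%R); last first.
  by apply/funext => x; rewrite !mxE.
by apply: measurable_funB => //; exact: measurable_coord.
Qed.

Lemma lebesgue_cV_translation n (t : 'cV[R]_n) (A : set 'cV[R]_n) :
  measurable A -> lebesgue_cV ((fun v => v - t)%R @^-1` A) = lebesgue_cV A.
Proof.
elim: n => [|n IH] in t A *.
  move=> mA; congr (lebesgue_cV _); apply/seteqP; split => v /=;
    by rewrite (_ : v - t = v)%R//; apply/matrixP => -[].
move=> mA; rewrite /= /pushforward.
pose t' := dsubmx (t : 'cV_(1 + n)).
have mcA : measurable (@cV_cons R n @^-1` A).
  by rewrite -[X in measurable X]setTI; exact: measurable_cV_cons.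
have /= <- := @product_measure_preserving _ _ _ _ (@lebesgue_measure R)
  (@lebesgue_cV R n) (fun x => x - t ord0 ord0)%R (fun v => v - t')%R
  _ (measurable_translation t') (@lebesgue_measure_translation (t ord0 ord0))
  (IH t') _ mcA.
  congr ((@lebesgue_measure R \x @lebesgue_cV R n) _).
  rewrite -comp_preimage; congr (_ @^-1` A); apply/funext => -[x v] /=.
  rewrite /cV_cons; apply/matrixP => i j; rewrite !mxE.
  case: fintype.splitP => k ik; rewrite !mxE.
    congr (_ - t _ _)%R; apply/val_inj => //=; last by rewrite ord1.
    by rewrite ik; case: k {ik} => -[].
  congr (_ - t _ _)%R; first exact/val_inj.
exact: measurable_funB.
Qed.

End translation_invariance.

(** Each [nu n] is almost carried by some [F M], but eventually leaves every fixed [F N]. Along a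
    subsequence it therefore lives, up to small errors, on consecutive disjoint shells. With [A] the
    union of every other shell, half of the subsequence is small on [A] and the other half on its
    complement. *)
Lemma sliding_hump {R : realType} d (T : measurableType d)
    (nu : nat -> set T -> R) (F : nat -> set T) :
  (forall n A B C, measurable A -> measurable B -> measurable C ->
     A `<=` B `|` C -> nu n A <= nu n B + nu n C) ->
  (forall N, measurable (F N)) ->
  {homo F : N M / (N <= M)%N >-> N `<=` M} ->
  (forall n e, 0 < e -> exists N, forall M, (N <= M)%N -> nu n (~` F M) <= e) ->
  (forall N e, 0 < e -> exists M, forall n, (M <= n)%N -> nu n (F N) <= e) ->
  exists A, [/\ measurable A,
    forall e M, 0 < e -> exists2 n, (M <= n)%N & nu n A <= e &
    forall e M, 0 < e -> exists2 n, (M <= n)%N & nu n (~` A) <= e].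
Proof.
move=> nuU mF ndF nuC nuF.
pose eps k : R := k.+1%:R^-1.
have eps0 k : 0 < eps k by rewrite invr_gt0.
have stepP k (p : nat * nat) : exists p' : nat * nat,
  [/\ (p.1 < p'.1)%N, (p.2 < p'.2)%N, nu p.2 (~` F p'.1) <= eps k &
      nu p'.2 (F p'.1) <= eps k].
  (* First a set large enough to carry almost all of the current [nu p.2], then an index so late
     that the next one has almost left this set. *)
  have [N1 HN1] := nuC p.2 _ (eps0 k).
  pose N' := maxn N1 p.1.+1.
  have [M1 HM1] := nuF N' _ (eps0 k).
  exists (N', maxn M1 p.2.+1); split => /=.
  - exact: leq_maxr.
  - exact: leq_maxr.
  - by apply: HN1; exact: leq_maxl.
  - by apply: HM1; exact: leq_maxl.
pose step k p := projT1 (cid (stepP k p)).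
have step_spec k p := projT2 (cid (stepP k p)).
pose p := fix p k := if k is k'.+1 then step k' (p k') else (0%N, 0%N).
pose N k := (p k).1; pose n k := (p k).2.
have Nlt k : (N k < N k.+1)%N by have [] := step_spec k (p k).
have nlt k : (n k < n k.+1)%N by have [] := step_spec k (p k).
have nuCk k : nu (n k) (~` F (N k.+1)) <= eps k by have [] := step_spec k (p k).
have nuFk k : nu (n k.+1) (F (N k.+1)) <= eps k by have [] := step_spec k (p k).
have Nle : {homo N : i j / (i <= j)%N}.
  by apply: homo_leq => [//|i j k|k]; [exact: leq_trans|exact: ltnW].
have nge k : (k <= n k)%N by elim: k => // k IH; exact: leq_ltn_trans (nlt k).
(* For positive [j], [nu (n j)] is concentrated on the shell [B j]. As [A] consists of the odd
   shells, indices [n k.*2.+2] are small on [A] and indices [n k.*2.+1] on the complement. *)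
pose B j := F (N j.+1) `\` F (N j).
pose A := \bigcup_j B j.*2.+1.
have mB j : measurable (B j) by exact: measurableD.
have mA : measurable A by exact: bigcup_measurable.
have epsS k : eps k.+1 <= eps k.
  by rewrite lef_pV2 ?posrE// ler_nat.
have key C k : measurable C -> C `<=` F (N k.+1) `|` ~` F (N k.+2) ->
    nu (n k.+1) C <= 2 * eps k.
  move=> mC /(nuU (n k.+1) _ _ _ mC (mF _) (measurableC (mF _))) /le_trans -> //.
  by have := nuFk k; have := nuCk k.+1; have := epsS k; lra.
have small (e : R) (M : nat) : 0 < e -> exists2 k, (M <= k)%N &
    2 * eps k.*2 <= e /\ 2 * eps k.*2.+1 <= e.
  move=> e0; have [k0 Hk0] := ltr_add_invr (divr_gt0 e0 (ltr0n R 2)).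
  rewrite add0r in Hk0.
  have ek k : (k0 <= k)%N -> 2 * eps k <= e.
    move=> kk; have : eps k <= eps k0 by rewrite lef_pV2 ?posrE// ler_nat.
    have : eps k0 < e / 2 by exact: Hk0.
    lra.
  exists (maxn M k0); first exact: leq_maxl.
  have k0k : (k0 <= (maxn M k0).*2)%N.
    by rewrite -addnn (leq_trans (leq_maxr M k0))// leq_addr.
  by split; apply: ek => //; exact: leqW.
exists A; split => // e M e0; have [k Mk [k1 k2]] := small e M e0.
- exists (n k.*2.+2).
    by rewrite (leq_trans Mk)// (leq_trans _ (nge _))// leqW// leqW// -addnn leq_addr.
  apply: le_trans k2; apply: key => // z [j _ [zF zNF]].
  have [jk|kj] := leqP j k.
    by left; apply: ndF zF; apply: Nle; rewrite !ltnS leq_double.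
  by right => zF'; apply: zNF; apply: ndF zF'; apply: Nle; rewrite ltnS -doubleS leq_double.
- exists (n k.*2.+1).
    by rewrite (leq_trans Mk)// (leq_trans _ (nge _))// leqW// -addnn leq_addr.
  apply: le_trans k1; apply: key; first exact: measurableC.
  move=> z Az; have [zF|zF] := pselect (F (N k.*2.+1) z); first by left.
  by right => zF'; apply: Az; exists k.
Qed.

(** * Integrals of simple functions *)

Section complex_exponential.
Context {R : realType}.
Local Open Scope complex_scope.

Lemma expC0 : expC 0 = 1 :> R[i].
Proof. by rewrite /expC expR0 cos0 sin0 mul1r. Qed.

Lemma Re_expC (z : R[i]) :
  complex.Re (expC z) = expR (complex.Re z) * cos (complex.Im z).
Proof. by rewrite /expC /= mul0r subr0. Qed.

Lemma expCD (z w : R[i]) : expC (z + w) = expC z * expC w.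
Proof.
case: z => a b; case: w => a' b'; apply/eqP; rewrite eq_complex /=.
rewrite expRD cosD sinD !mul0r !subr0 !addr0.
by apply/andP; split; apply/eqP; ring.
Qed.

Lemma expC_sum (I : Type) (s : seq I) (f : I -> R[i]) :
  expC (\sum_(i <- s) f i) = \prod_(i <- s) expC (f i).
Proof.
by elim: s => [|i s IH]; rewrite ?big_nil ?expC0// !big_cons expCD IH.
Qed.

End complex_exponential.

Section linear_functionals.
Context {R : realType} {S : ptopologicalType} (l d : nat).
Local Notation SR := (borel S * 'cV[R]_l)%type.
Implicit Types (F G : seq ('cV[R]_d * set SR)) (A : set SR).

(* The list [F] stands for the simple vector-valued function [coef F]; the sets
   in it may overlap. *)
Definition coef F (z : SR) : 'cV[R]_d := \sum_(p <- F) \1_(p.2) z *: p.1.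

Definition restr A F := [seq (p.1, A `&` p.2) | p <- F].

Definition opp_coef F := [seq (- p.1, p.2) | p <- F].

Definition translate (t : 'cV[R]_l) F :=
  [seq (p.1, (fun z : SR => (z.1, z.2 - t)) @^-1` p.2) | p <- F].

Lemma coef_cat F G z : coef (F ++ G) z = coef F z + coef G z.
Proof. by rewrite /coef big_cat. Qed.

Lemma coef_restr A F z : coef (restr A F) z = \1_A z *: coef F z.
Proof.
rewrite /coef big_map scaler_sumr; apply: eq_bigr => p _ /=.
by rewrite indicI scalerA.
Qed.

Lemma coef_opp F z : coef (opp_coef F) z = - coef F z.
Proof.
by rewrite /coef big_map -sumrN; apply: eq_bigr => p _ /=; rewrite scalerN.
Qed.

Lemma coef_translate t F z : coef (translate t F) z = coef F (z.1, z.2 - t).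
Proof. by rewrite /coef big_map. Qed.

Lemma restr_cat A F G : restr A (F ++ G) = restr A F ++ restr A G.
Proof. exact: map_cat. Qed.

Lemma restr_opp A F : restr A (opp_coef F) = opp_coef (restr A F).
Proof. by rewrite /restr /opp_coef -!map_comp. Qed.

Lemma restr_translate A t F :
  restr A (translate t F) =
  translate t (restr ((fun z : SR => (z.1, z.2 + t)) @^-1` A) F).
Proof.
rewrite /restr /translate -!map_comp; apply: eq_map => p /=; congr (_, _).
rewrite preimage_setI; congr (_ `&` _); apply/seteqP; split => -[s v] /=;
  by rewrite subrK.
Qed.

Context (rho : probability (borel S) R) {dO : measure_display}
  {Omega : measurableType dO} {P : probability Omega R}
  (Lambda : set SR -> {RV P >-> 'cV[R]_d}).

Definition lin F (w : Omega) : R := \sum_(p <- F) dotp p.1 (Lambda p.2 w).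

Definition B0_all F := {in F, forall p, B0 rho p.2}.

Lemma lin_cat F G w : lin (F ++ G) w = lin F w + lin G w.
Proof. by rewrite /lin big_cat. Qed.

Lemma lin_opp F w : lin (opp_coef F) w = - lin F w.
Proof.
by rewrite /lin big_map -sumrN; apply: eq_bigr => p _ /=; rewrite dotpNl.
Qed.

Lemma measurable_lin F : measurable_fun setT (lin F).
Proof.
apply: measurable_sum => p; apply: measurableT_comp => //.
exact: measurable_dotp.
Qed.

Lemma B0_all_cat F G : B0_all F -> B0_all G -> B0_all (F ++ G).
Proof. by move=> HF HG p; rewrite mem_cat => /orP[/HF|/HG]. Qed.

Lemma B0_all_opp F : B0_all F -> B0_all (opp_coef F).
Proof. by move=> HF p /mapP[p' /HF ? ->]. Qed.

Lemma B0_sub (B B' : set SR) : measurable B' -> B' `<=` B -> B0 rho B -> B0 rho B'.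
Proof.
move=> mB' B'B [mB Boo]; split => //; rewrite (le_lt_trans _ Boo)//.
by apply: le_measure => //; rewrite inE.
Qed.

Lemma B0_all_restr A F : measurable A -> B0_all F -> B0_all (restr A F).
Proof.
move=> mA HF p /mapP[p' p'F ->] /=; have [mB Boo] := HF _ p'F.
by apply: (B0_sub _ _ (HF _ p'F)); [exact: measurableI|exact: subIsetr].
Qed.

Lemma measurable_translateSR (t : 'cV[R]_l) :
  measurable_fun setT (fun z : SR => (z.1, z.2 - t)).
Proof.
apply/measurable_fun_pairP; split => /=; first exact: measurable_fst.
exact: (measurableT_comp (measurable_translation t) measurable_snd).
Qed.

Lemma Pi_translate (t : 'cV[R]_l) A : measurable A ->
  Pi rho ((fun z : SR => (z.1, z.2 - t)) @^-1` A) = Pi rho A.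
Proof.
move=> mA; exact: (@product_measure_preserving _ _ _ _ _ rho (@lebesgue_cV R l)
  id (fun v => v - t) (@measurable_id _ _ _) (measurable_translation t)
  (fun _ _ => erefl) (@lebesgue_cV_translation _ _ t)).
Qed.

Lemma B0_all_translate t F : B0_all F -> B0_all (translate t F).
Proof.
move=> HF p /mapP[p' /HF[mB Boo] ->] /=; split.
  by rewrite -[X in measurable X]setTI; exact: measurable_translateSR.
by rewrite Pi_translate.
Qed.

End linear_functionals.

Section levy_basis_theory.
Context {R : realType} {S : ptopologicalType} (l d : nat).
Local Notation SR := (borel S * 'cV[R]_l)%type.
Context (gamma : 'cV[R]_d) (Sigma : 'M[R]_d)
  (Q : {measure set 'cV[R]_d -> \bar R}) (rho : probability (borel S) R)
  {dO : measure_display} {Omega : measurableType dO} {P : probability Omega R}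
  (Lambda : set SR -> {RV P >-> 'cV[R]_d}).
Hypothesis LB : levy_basis rho gamma Sigma Q Lambda.
Implicit Types (F G : seq ('cV[R]_d * set SR)) (A : set SR).
Local Notation psi := (cumulant gamma Sigma Q).
Local Notation mu := (rho \x @lebesgue_cV R l)%E.
Local Open Scope complex_scope.

Let mlin G : measurable_fun setT (lin Lambda G).
Proof. exact: measurable_lin. Qed.

Lemma B0_set0 : B0 rho (set0 : set SR).
Proof. by split => //; rewrite /Pi measure0. Qed.

Lemma B0_setU A B : B0 rho A -> B0 rho B -> B0 rho (A `|` B).
Proof.
move=> [mA Aoo] [mB Boo]; split; first exact: measurableU.
by rewrite (le_lt_trans (measureU2 mu mA mB))// lte_add_pinfty.
Qed.

(** Additivity for the constant sequence [set0] makes the partial sums of a constant series converge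
    almost surely; their increments, all equal to the value at [set0], then tend to 0. *)
Lemma levy_basis0 : {ae P, forall w, Lambda set0 w = 0}.
Proof.
have t0 : trivIset setT (fun _ : nat => set0 : set SR).
  by apply/trivIsetP => *; rewrite setI0.
have := @levy_basis_additive _ _ _ _ _ _ _ _ _ _ _ _ LB _ (fun=> B0_set0) t0.
rewrite bigcup0// => /(_ B0_set0); apply: filterS => w cv.
have cv1 := cv; rewrite -cvg_shiftS in cv1.
have cv0 : (fun _ : nat => Lambda set0 w) @ \oo --> (0 : 'cV[R]_d).
  have := cvgB cv1 cv; rewrite subrr => H; apply: cvg_trans (H _).
  apply: near_eq_cvg; apply: nearW => n.
  by rewrite /= fctE big_nat_recr//= addrAC subrr add0r.
by apply: (@cvg_unique _ (@norm_hausdorff _ _) _ _ _ _ _ cv0); exact: cvg_cst.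
Qed.

(** The finite family is enumerated and padded with empty sets, so that countable additivity
    applies; [levy_basis0] discards the padding. *)
Lemma levy_basis_finite_additive (I : finType) (D : I -> set SR) :
  (forall i, B0 rho (D i)) -> trivIset setT D ->
  {ae P, forall w, Lambda (\bigcup_i D i) w = \sum_i Lambda (D i) w}.
Proof.
move=> BD tD; pose n := #|I|.
pose E (k : nat) : set SR :=
  if insub k is Some j then D (enum_val (j : 'I_n)) else set0.
have EN k (kn : (k < n)%N) : E k = D (enum_val (Ordinal kn)).
  by rewrite /E insubT.
have E0 k : (n <= k)%N -> E k = set0.
  by move=> nk; rewrite /E insubF// ltnNge nk.
have BE k : B0 rho (E k).
  by rewrite /E; case: insub => [j|]; [exact: BD|exact: B0_set0].
have tE : trivIset setT E.
  move=> i j _ _; rewrite /E; case: insubP => [i' _ <-|_ [z []//]].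
  case: insubP => [j' _ <-|_ [z []//]] => zz.
  by congr nat_of_ord; apply: enum_val_inj; exact: tD zz.
have UE : \bigcup_k E k = \bigcup_i D i.
  apply/seteqP; split => z [k _].
    by rewrite /E; case: insub => // j Dz; exists (enum_val j).
  move=> Dz; exists (enum_rank k) => //; rewrite (EN _ (ltn_ord _)).
  rewrite (_ : Ordinal _ = enum_rank k) ?enum_rankK//; exact/val_inj.
have BU : B0 rho (\bigcup_k E k).

  have -> : \bigcup_k E k = \big[setU/set0]_(i < n) E i.
    rewrite -bigcup_mkord; apply/seteqP; split => z [k kn Ez]; exists k => //=.
    by rewrite ltnNge; apply/negP => nk; move: Ez; rewrite E0.
  by apply: big_ind => [|A B|k _]; [exact: B0_set0|exact: B0_setU|exact: BE].
have := levy_basis_additive LB BE tE BU.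
rewrite UE; apply: filterS2 levy_basis0 => w L0 cv.
apply: (@cvg_unique _ (@norm_hausdorff _ _) _ _ _ _ cv).
apply: cvg_near_cst; near=> m.
have nm : (n <= m)%N by near: m; exact: nbhs_infty_ge.
have -> : \sum_(0 <= k < m) Lambda (E k) w = \sum_(0 <= k < n) Lambda (E k) w.
  rewrite (big_cat_nat (leq0n n) nm)//= [X in _ + X]big_nat_cond.
  rewrite [X in _ + X]big1 ?addr0// => i /andP[/andP[ni _] _].
  by rewrite E0// L0.
rewrite big_mkord (@big_enum_val _ _ _ _ I (fun i => Lambda (D i) w)).
apply: eq_bigr => i _; rewrite (EN _ (ltn_ord i)).
rewrite (_ : Ordinal _ = i)//; exact/val_inj.
Unshelve. all: by end_near.
Qed.

Lemma charf_disjoint n (c : 'I_n -> 'cV[R]_d) (D : 'I_n -> set SR) :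
  (forall i, B0 rho (D i)) -> trivIset setT D ->
  charf P (fun w => \sum_(i < n) dotp (c i) (Lambda (D i) w)) =
  expC (\sum_(i < n) psi (c i) * (fine (mu (D i)))%:C).
Proof.
move=> BD tD.
rewrite (charf_independent_sum (X := fun i => Lambda (D i))
  (phi := fun i => dotp (c i))); last 2 first.
- by move=> i; exact: measurable_dotp.
- exact: levy_basis_indep LB _ _ BD tD.
rewrite expC_sum; apply: eq_bigr => i _.
exact: levy_basis_factorisable LB _ _ (BD i).
Qed.

(* Refining [F] to the atoms of the algebra generated by its sets. *)
Lemma disjoint_refinement F : B0_all rho F ->
  exists n (c : 'I_n -> 'cV[R]_d) (D : 'I_n -> set SR),
  [/\ forall j, B0 rho (D j), trivIset setT D,
      forall g : 'cV[R]_d -> R, g 0 = 0 ->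
        forall z, g (coef F z) = \sum_j g (c j) * \1_(D j) z &
      {ae P, forall w, lin Lambda F w = \sum_j dotp (c j) (Lambda (D j) w)} ].
Proof.
move=> BF; pose m := size F.
pose cF (i : 'I_m) := (tnth (in_tuple F) i).1.
pose BB (i : 'I_m) := (tnth (in_tuple F) i).2.
have BBP i : B0 rho (BB i) by apply: BF; exact: mem_tnth.
have coefE z : coef F z = \sum_i \1_(BB i) z *: cF i by rewrite /coef big_tnth.
have linE w : lin Lambda F w = \sum_i dotp (cF i) (Lambda (BB i) w).
  by rewrite /lin big_tnth.
(* [at_ a] holds the points lying in exactly the sets with index in [a]. Requiring membership in at
   least one set empties the atom of the empty index set, which would otherwise be the complement of
   the union and could have infinite measure. *)
pose at_ (a : {set 'I_m}) : set SR :=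
  [set z | (exists i, BB i z) /\ forall i, i \in a <-> BB i z].
have atE a : at_ a = (\bigcup_i BB i) `&`
    \bigcap_i (if i \in a then BB i else ~` BB i).
  apply/seteqP; split => z [].
    move=> [i Bz] az; split; first by exists i.
    by move=> j _; case: ifPn => [/az//|/negP ja Bj]; apply: ja; exact/az.
  move=> [i _ Bz] az; split; first by exists i.
  move=> j; have := az j I; case: ifPn => [ja Bj|_ nBj]; first by [].
  by split.
have mat a : measurable (at_ a).
  rewrite atE; apply: measurableI.
    by apply: fin_bigcup_measurable => // i _; case: (BBP i).
  apply: fin_bigcap_measurable => // i _; case: ifP => _; case: (BBP i) => // + _.
  exact: measurableC.
have Bat a : B0 rho (at_ a).
  have [->|[i ia]] := set_0Vmem a.
    rewrite (_ : at_ _ = set0); first exact: B0_set0.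
    by apply/seteqP; split => // z [[i Bz] az]; have /az := Bz; rewrite inE.
  by apply: (B0_sub (mat a) _ (BBP i)) => z [_ az]; exact/az.
have tat : trivIset setT at_.
  move=> a b _ _ [z [[_ az] [_ bz]]]; apply/setP => i.
  by apply/idP/idP => [/az/bz|/bz/az].
pose ca (a : {set 'I_m}) : 'cV[R]_d := \sum_(i in a) cF i.
have coef_at a z : at_ a z -> coef F z = ca a.
  move=> [_ az]; rewrite coefE /ca [RHS]big_mkcond/=; apply: eq_bigr => i _.
  rewrite indicE; case: ifPn => [/az Bz|/negP ia].
    by rewrite mem_set// scale1r.
  by rewrite memNset ?scale0r// => Bz; apply: ia; exact/az.
have coef_out z : ~ (exists i, BB i z) -> coef F z = 0.
  move=> nB; rewrite coefE big1// => i _.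
  by rewrite indicE memNset ?scale0r// => Bz; apply: nB; exists i.
have gE (g : 'cV[R]_d -> R) : g 0 = 0 ->
    forall z, g (coef F z) = \sum_a g (ca a) * \1_(at_ a) z.
  move=> g0 z; have [Bz|nB] := pselect (exists i, BB i z); last first.
    rewrite coef_out// g0 big1// => a _.
    by rewrite indicE memNset ?mulr0// => -[].
  pose a : {set 'I_m} := [set i | `[< BB i z >]]%SET.
  have az : at_ a z by split => // i; rewrite inE; split => /asboolP.
  rewrite (bigD1 a)//= big1 ?addr0.
    by rewrite (coef_at _ _ az) indicE mem_set// mulr1.
  move=> b ba; rewrite indicE memNset ?mulr0// => bz.
  by move/eqP: ba; apply; apply: tat => //; exists z.
have UB i : \bigcup_(a : {set 'I_m}) (if i \in a then at_ a else set0) = BB i.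
  apply/seteqP; split => z.
    by move=> [a _]; case: ifP => // ia [_ az]; exact/az.
  move=> Bz; pose a : {set 'I_m} := [set i | `[< BB i z >]]%SET.
  exists a => //; rewrite ifT; last by rewrite inE; exact/asboolP.
  split; first by exists i.
  by move=> j; rewrite inE; split => /asboolP.
have LBB i : {ae P, forall w,
    Lambda (BB i) w = \sum_(a : {set 'I_m} | i \in a) Lambda (at_ a) w}.
  pose D' (a : {set 'I_m}) := if i \in a then at_ a else set0.
  have BD' a : B0 rho (D' a).
    by rewrite /D'; case: ifP => _; [exact: Bat|exact: B0_set0].
  have tD' : trivIset setT D'.
    move=> a b _ _ [z []]; rewrite /D'; case: ifP => // _ az; case: ifP => // _ bz.
    by apply: tat => //; exists z.
  have := levy_basis_finite_additive BD' tD'; rewrite UB.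
  apply: filterS2 levy_basis0 => w L0 ->; rewrite [RHS]big_mkcond/=.
  by apply: eq_bigr => a _; rewrite /D'; case: ifP => // _; rewrite L0.
have linA : {ae P, forall w, lin Lambda F w = \sum_a dotp (ca a) (Lambda (at_ a) w)}.
  have : {ae P, forall w, forall i,
      Lambda (BB i) w = \sum_(a : {set 'I_m} | i \in a) Lambda (at_ a) w}.
    by apply: filter_forall => i; exact: LBB.
  apply: filterS => w Hw; rewrite linE.
  under eq_bigr do rewrite Hw dotp_sumr big_mkcond/=.
  rewrite exchange_big/=; apply: eq_bigr => a _.
  by rewrite /ca dotp_suml [RHS]big_mkcond.
exists #|{set 'I_m}|, (fun j => ca (enum_val j)), (fun j => at_ (enum_val j)).
split => //.
- move=> i j _ _ zz; apply: enum_val_inj; exact: tat zz.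
- move=> g g0 z; rewrite gE//.
  by rewrite (@big_enum_val _ _ _ _ {set 'I_m} (fun a => g (ca a) * \1_(at_ a) z)).
- apply: filterS linA => w ->.
  by rewrite (@big_enum_val _ _ _ _ {set 'I_m} (fun a => dotp (ca a) (Lambda (at_ a) w))).
Qed.

Let iindic A (r : R) : B0 rho A ->
  mu.-integrable setT (EFin \o (fun z => r * \1_A z)) /\
  \int[mu]_z (r * \1_A z) = r * fine (mu A).
Proof.
move=> [mA Aoo].
have iA : mu.-integrable setT (EFin \o (\1_A : SR -> R)).
  apply/integrableP; split; first by apply/measurable_EFinP; exact: measurable_indic.
  under eq_integral => z _ do rewrite /= ger0_norm//.
  by rewrite integral_indic// setIT.
split; first exact: RintegrableZ.
have /= -> := RintegralZl r measurableT iA.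
by rewrite /Rintegral integral_indic// setIT.
Qed.

Let isum (s : seq (R * set SR)) : {in s, forall p, B0 rho p.2} ->
  mu.-integrable setT (EFin \o (fun z => \sum_(p <- s) p.1 * \1_(p.2) z)) /\
  \int[mu]_z (\sum_(p <- s) p.1 * \1_(p.2) z) =
  \sum_(p <- s) p.1 * fine (mu p.2).
Proof.
elim: s => [_|p s IH Bs].
  rewrite big_nil; under [X in _ \o X]eq_fun do rewrite big_nil.
  under eq_Rintegral do rewrite big_nil.
  have [] := iindic 0 B0_set0; under [X in _ \o X]eq_fun do rewrite mul0r.
  by under eq_Rintegral do rewrite mul0r; rewrite mul0r.
have [i1 e1] : _ /\ _ := iindic p.1 (Bs p (mem_head _ _)).
have [|i2 e2] := IH; first by move=> p' p's; apply: Bs; rewrite inE p's orbT.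
rewrite big_cons; under [X in _ \o X]eq_fun do rewrite big_cons.
under eq_Rintegral do rewrite big_cons.
split; first exact: RintegrableD i1 i2.
by have /= -> := RintegralD measurableT i1 i2; rewrite e1 e2.
Qed.

(** As [g 0 = 0], nothing is left outside the finitely many atoms, and [g (coef F z)] is a
    combination of indicators of sets of finite measure. *)
Lemma integrable_coef F (g : 'cV[R]_d -> R) : B0_all rho F -> g 0 = 0 ->
  mu.-integrable setT (EFin \o (fun z => g (coef F z))).
Proof.
move=> BF g0; have [n [c [D [BD _ gE _]]]] := disjoint_refinement BF.
have [|+ _] := @isum [seq (g (c j), D j) | j : 'I_n].
  by move=> _ /mapP[j _ ->]; exact: BD.
congr (mu.-integrable _ (EFin \o _)); apply/funext => z.
by rewrite gE// big_map big_enum.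
Qed.

(** On the disjoint refinement both sides reduce to the same finite sum in the exponent. This is
    where overlapping sets in [F] become harmless: the law depends on [F] only through [coef F]. *)
Lemma charf_lin F : B0_all rho F ->
  charf P (lin Lambda F) = expC (integralC mu (fun z => psi (coef F z))).
Proof.
move=> BF; have [n [c [D [BD tD gE linE]]]] := disjoint_refinement BF.
have psi0 := cumulant0 gamma Sigma Q.
have [|_ re] := @isum [seq (complex.Re (psi (c j)), D j) | j : 'I_n].
  by move=> _ /mapP[j _ ->]; exact: BD.
have [|_ im] := @isum [seq (complex.Im (psi (c j)), D j) | j : 'I_n].
  by move=> _ /mapP[j _ ->]; exact: BD.
rewrite (ae_eq_charf _ _ linE); last 2 first.
- exact: measurable_lin.
- by apply: measurable_sum => j; apply: measurableT_comp => //; exact: measurable_dotp.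
rewrite charf_disjoint//; congr expC; rewrite /integralC.
have -> : \int[mu]_z complex.Re (psi (coef F z)) =
    \sum_j complex.Re (psi (c j)) * fine (mu (D j)).
  rewrite big_map big_enum/= in re; rewrite -re; apply: eq_Rintegral => z _.
  by rewrite (gE (fun x => complex.Re (psi x))) ?psi0// big_map big_enum.
have -> : \int[mu]_z complex.Im (psi (coef F z)) =
    \sum_j complex.Im (psi (c j)) * fine (mu (D j)).
  rewrite big_map big_enum/= in im; rewrite -im; apply: eq_Rintegral => z _.
  by rewrite (gE (fun x => complex.Im (psi x))) ?psi0// big_map big_enum.
elim/big_rec3 : _ => [//|j a b w _ ->].
by apply/eqP; rewrite eq_complex /= !mulr0 subr0 add0r !eqxx.
Qed.

Let psi0 : psi 0 = 0 := cumulant0 gamma Sigma Q.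

Let iRe F : B0_all rho F ->
  mu.-integrable setT (EFin \o (fun z => complex.Re (psi (coef F z)))).
Proof.
by move=> BF; apply: (integrable_coef (g := fun x => complex.Re (psi x)) BF); rewrite psi0.
Qed.

Let iIm F : B0_all rho F ->
  mu.-integrable setT (EFin \o (fun z => complex.Im (psi (coef F z)))).
Proof.
by move=> BF; apply: (integrable_coef (g := fun x => complex.Im (psi x)) BF); rewrite psi0.
Qed.

Definition cumulant_norm (x : 'cV[R]_d) : R :=
  `|complex.Re (psi x)| + `|complex.Im (psi x)|.

Lemma cumulant_norm_ge0 x : 0 <= cumulant_norm x.
Proof. by rewrite addr_ge0. Qed.

Lemma cumulant_norm0 : cumulant_norm 0 = 0.
Proof. by rewrite /cumulant_norm psi0 /= normr0 addr0. Qed.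

Lemma integrable_cumulant_norm F : B0_all rho F ->
  mu.-integrable setT (EFin \o (fun z => cumulant_norm (coef F z))).
Proof. by move=> BF; exact: (integrable_coef BF cumulant_norm0). Qed.

Lemma cosdef_lin_le F : B0_all rho F ->
  cosdef P (lin Lambda F) <= \int[mu]_z cumulant_norm (coef F z).
Proof.
move=> BF; rewrite (cosdefE P (measurable_lin Lambda F)) (charf_lin BF) Re_expC.
have iR := iRe BF; have iI := iIm BF.
have := RintegralD measurableT (integrable_norm iR) (integrable_norm iI).
rewrite /cumulant_norm => /= ->.
apply: expR_cos_defect_le.
- rewrite -oppr_ge0 -[X in 0 <= X]mulN1r.
  have /= <- := RintegralZl (-1) measurableT iR.
  apply: Rintegral_ge0 => z _; rewrite mulN1r oppr_ge0.
  exact: Re_cumulant_le0 (levy_basis_triplet LB) _.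
- exact: le_normr_Rintegral measurableT iR.
- exact: le_normr_Rintegral measurableT iI.
Qed.

Lemma Rintegral_translate t (g : SR -> R) : mu.-integrable setT (EFin \o g) ->
  mu.-integrable setT (EFin \o (fun z => g (z.1, z.2 - t))) ->
  \int[mu]_z g (z.1, z.2 - t) = \int[mu]_z g z.
Proof.
move=> ig igt; have mt := @measurable_translateSR R S l t.
have E : (\int[mu]_z (g (z.1, z.2 - t)%R)%:E = \int[mu]_z (g z)%:E)%E.
  transitivity (\int[pushforward mu (fun z : SR => (z.1, z.2 - t)%R)]_z (g z)%:E)%E.
    exact: esym (integral_pushforward mt (measurable_int _ ig) igt measurableT).
  by apply: eq_measure_integral => A mA _; exact: Pi_translate.
by rewrite /Rintegral E.
Qed.

Lemma integralC_translate t (g : SR -> R[i]) :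
  mu.-integrable setT (EFin \o (fun z => complex.Re (g z))) ->
  mu.-integrable setT (EFin \o (fun z => complex.Im (g z))) ->
  mu.-integrable setT (EFin \o (fun z => complex.Re (g (z.1, z.2 - t)))) ->
  mu.-integrable setT (EFin \o (fun z => complex.Im (g (z.1, z.2 - t)))) ->
  integralC mu (fun z => g (z.1, z.2 - t)) = integralC mu g.
Proof.
move=> iR iI iRt iIt; rewrite /integralC.
by rewrite (Rintegral_translate iR iRt) (Rintegral_translate iI iIt).
Qed.

Lemma charf_translate t F : B0_all rho F ->
  charf P (lin Lambda (translate t F)) = charf P (lin Lambda F).
Proof.
move=> BF; have BtF := @B0_all_translate R S l d rho t F BF.
rewrite (charf_lin BF) (charf_lin BtF).
have E : coef (translate t F) = (fun z => coef F (z.1, z.2 - t)).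
  by apply/funext => z; rewrite coef_translate.
have := iRe BtF; have := iIm BtF; rewrite E => iI iR.
apply: (congr1 expC).
exact: (integralC_translate (g := fun z => psi (coef F z)) (iRe BF) (iIm BF) iR iI).
Qed.

Lemma cosdef_translate t F : B0_all rho F ->
  cosdef P (lin Lambda (translate t F)) = cosdef P (lin Lambda F).
Proof.
by move=> BF; rewrite !cosdefE ?(charf_translate _ BF)//; exact: measurable_lin.
Qed.

(** Because [psi 0 = 0], [psi] is additive at every point where one of the two coefficients
    vanishes, so the exponents add. The sets listed in [F] may meet those listed in [G]; only the
    supports of the coefficient functions count. *)
Lemma charf_lin_disjoint F G : B0_all rho F -> B0_all rho G ->
  (forall z, coef F z = 0 \/ coef G z = 0) ->
  charf P (fun w => lin Lambda F w + lin Lambda G w) =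
  charf P (lin Lambda F) * charf P (lin Lambda G).
Proof.
move=> BF BG FG.
rewrite (_ : (fun w => _) = lin Lambda (F ++ G)); last first.
  by apply/funext => w; rewrite lin_cat.
rewrite (charf_lin BF) (charf_lin BG) (charf_lin (B0_all_cat BF BG)).
rewrite -expCD.
have psiD : (fun z => psi (coef (F ++ G) z)) =
    (fun z => psi (coef F z) + psi (coef G z)).
  apply/funext => z; rewrite coef_cat.
  by have [->|->] := FG z; rewrite psi0 !(add0r, addr0).
apply: (congr1 expC).
apply: etrans (integralCD (iRe BF) (iIm BF) (iRe BG) (iIm BG)).
exact: (congr1 (integralC mu) psiD).
Qed.

(** The difference is the integral of a list whose coefficient function is 0, and [cosdef_lin_le]
    bounds its defect by the integral of 0. *)
Lemma cosdef_eq_coef F G : B0_all rho F -> B0_all rho G -> coef F =1 coef G ->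
  cosdef P (fun w => lin Lambda F w - lin Lambda G w) = 0.
Proof.
move=> BF BG FG; apply/eqP; rewrite eq_le cosdef_ge0 andbT.
rewrite (eq_cosdef P (W := lin Lambda (F ++ opp_coef G))); last first.
  by move=> w; rewrite lin_cat lin_opp.
rewrite (le_trans (cosdef_lin_le (B0_all_cat BF (B0_all_opp BG))))//.
under eq_Rintegral do rewrite coef_cat coef_opp FG subrr cumulant_norm0.
by rewrite /Rintegral integral0.
Qed.

Lemma cosdef_le_eq_coef F G : B0_all rho F -> B0_all rho G -> coef F =1 coef G ->
  cosdef P (lin Lambda F) <= 2 * cosdef P (lin Lambda G).
Proof.
move=> BF BG FG.
rewrite (eq_cosdef P (W := fun w => (lin Lambda F w - lin Lambda G w) + lin Lambda G w)).
  apply: le_trans (cosdefD P (measurable_funB (mlin F) (mlin G)) (mlin G)) _.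
  by rewrite (cosdef_eq_coef BF BG FG) add0r.
by move=> w; rewrite subrK.
Qed.

Let Rintegral_dct0 (h : nat -> SR -> R) (H : SR -> R) :
  (forall n, mu.-integrable setT (EFin \o h n)) ->
  mu.-integrable setT (EFin \o H) ->
  (forall n z, `|h n z| <= H z) ->
  {ae mu, forall z, (fun n => h n z) @ \oo --> (0 : R)} ->
  forall e, 0 < e -> exists N, forall n, (N <= n)%N -> \int[mu]_z h n z <= e.
Proof.
move=> ih iH hH h0 e e0.
have c1 : {ae mu, forall x, setT x -> (fun n => (h n x)%:E) @ \oo --> 0%E}.
  by apply: filterS h0 => x hx _; apply/cvg_EFin; [exact: nearW|exact: hx].
have d1 : {ae mu, forall x n, setT x -> (`|(h n x)%:E| <= (H x)%:E)%E}.
  by apply: aeW => x n _; rewrite lee_fin.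
have [_ _] := dominated_convergence measurableT (fun n => measurable_int _ (ih n))
  (measurable_cst 0%E) c1 iH d1.
rewrite integral0 => cv.
have {cv} : (fun n => \int[mu]_z h n z) @ \oo --> (0 : R).
  by have -> : (0 : R) = fine 0%E by []; apply: fine_cvg; exact: cv.
move/cvgr0_norm_le => /(_ e e0) [N _ HN]; exists N => n Nn.
exact: le_trans (ler_norm _) (HN n Nn).
Qed.

(* [coef (F n) z] may tend to 0 at every [z] while the integrals do not; the
   convergence over all [A] excludes this, by a sliding hump argument. *)
Lemma cosdef_lin_cvg0 (F : nat -> seq ('cV[R]_d * set SR)) :
  (forall n, B0_all rho (F n)) ->
  {ae mu, forall z, (fun n => coef (F n) z) @ \oo --> (0 : 'cV[R]_d)} ->
  (forall A e, measurable A -> 0 < e -> exists N, forall n m,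
     (N <= n)%N -> (N <= m)%N ->
     cosdef P (fun w => lin Lambda (restr A (F n)) w - lin Lambda (restr A (F m)) w)
     <= e) ->
  forall e, 0 < e -> exists N, forall n, (N <= n)%N -> cosdef P (lin Lambda (F n)) <= e.
Proof.
(* With x = e / 42, the defect over [A] is at most 2 (1 + 1) x = 4 x. Gluing [A] and its complement
   gives 2 (4 + 1) x, doubled to 20 x by the change of list, and the passage to all later indices
   gives 2 (1 + 20) x = 42 x. *)
have arith (s a b n x : R) : s <= 2 * (a + b) -> a <= 4 * x -> b <= n ->
  n <= x -> 2 * s <= 20 * x by lra.
have arith2 (s a b x : R) : s <= 2 * (a + b) -> a <= x / 42 ->
  b <= 20 * (x / 42) -> s <= x by lra.
move=> BF F0 cauchy.
have tri := levy_basis_triplet LB.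
have [M HM] := cumulant_bounded tri.
have cnM x : norm1 x <= 1 -> cumulant_norm x <= 2 * M.
  by move=> /HM[]; rewrite /cumulant_norm; lra.
have M0 : 0 <= 2 * M.
  apply: le_trans (cumulant_norm_ge0 0) (cnM 0 _).
  by rewrite /norm1 big1// => i _; rewrite mxE normr0.
have cn_cvg (x : nat -> 'cV[R]_d) : x @ \oo --> (0 : 'cV[R]_d) ->
    (fun n => cumulant_norm (x n)) @ \oo --> (0 : R).
  move=> /(cumulant_cvg0 tri)[/cvg_norm + /cvg_norm]; rewrite normr0 => a b.
  by have := cvgD a b; rewrite addr0 => H; exact: H.
pose nu n A := \int[mu]_z cumulant_norm (coef (restr A (F n)) z).
have cnE n A z : cumulant_norm (coef (restr A (F n)) z) =
    \1_A z * cumulant_norm (coef (F n) z).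
  rewrite coef_restr indicE; case: (_ \in _); first by rewrite scale1r mul1r.
  by rewrite scale0r mul0r cumulant_norm0.
have icn n A : measurable A ->
    mu.-integrable setT (EFin \o (fun z => cumulant_norm (coef (restr A (F n)) z))).
  by move=> mA; apply: (integrable_cumulant_norm); exact: B0_all_restr.
have icnF n : mu.-integrable setT (EFin \o (fun z => cumulant_norm (coef (F n) z))).
  exact: (integrable_cumulant_norm).
have [K [KT ndK Koo]] : exists K : nat -> set SR,
    [/\ setT = \bigcup_i K i, nondecreasing_seq K &
        forall i, measurable (K i) /\ (mu (K i) < +oo)%E].
  have /sigma_finiteP[V [VT ndV Voo]] := sigma_finiteT (@lebesgue_cV R l).
  exists (fun i => setT `*` V i); split.
  - apply/seteqP; split => // -[s v] _.
    have [i _ Vi] : (\bigcup_i V i) v by rewrite -VT.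
    by exists i.
  - move=> i j ij; apply/subsetPset => -[s v] [_ Vi]; split => //.
    by move: v Vi; exact/subsetPset/ndV.
  - move=> i; have [mV Vfin] := Voo i; split; first exact: measurableX.
    rewrite product_measure1E// lte_mul_pinfty//.
    exact: (fin_num_measure rho _ measurableT).
(* On [E N], of finite measure, all terms from [N] on lie in the unit ball, where [cumulant_norm] is
   at most [2 * M]: dominated convergence in [n] gives [nuF]. Almost every point lies in some [E N],
   so for fixed [n] dominated convergence in [N] gives [nuC]. *)
pose E N : set SR := K N `&` \bigcap_n [set z | (N <= n)%N -> norm1 (coef (F n) z) <= 1].
have mnorm n : measurable_fun setT (fun z => norm1 (coef (F n) z)).
  have n10 : norm1 (0 : 'cV[R]_d) = 0.
    by rewrite /norm1 big1// => i _; rewrite mxE normr0.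
  by have /measurable_int/measurable_EFinP := integrable_coef (BF n) n10.
have mE N : measurable (E N).
  apply: measurableI; first by case: (Koo N).
  apply: bigcapT_measurable => n; case: (leqP N n) => Nn.
    rewrite (_ : [set z | _] = (fun z => norm1 (coef (F n) z)) @^-1` `]-oo, 1]%classic).
      by rewrite -[X in measurable X]setTI; exact: mnorm.
    apply/seteqP; split => z; rewrite /= in_itv/=; last by [].
    by move=> /(_ isT).
  rewrite (_ : [set z | _] = setT)//.
  by apply/seteqP; split.
have ndE : {homo E : N M / (N <= M)%N >-> N `<=` M}.
  move=> N N' NN' z [KN EN]; split.
    by move: z KN {EN}; exact/subsetPset/ndK.
  by move=> n _ N'n; apply: EN => //; exact: leq_trans N'n.
have Eev : {ae mu, forall z, exists N, E N z}.
  apply: filterS F0 => z /cvg_norm1 cz.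
  move: (cz) => /cvgr0_norm_le/(_ 1 ltr01)[N1 _ HN1].
  have [N2 _ KN2] : (\bigcup_i K i) z by rewrite -KT.
  exists (maxn N1 N2); split.
    by move: z KN2 {cz HN1}; apply/subsetPset/ndK; exact: leq_maxr.
  move=> n _ /= Nn; rewrite (le_trans (ler_norm _))//; apply: HN1 => /=.
  exact: leq_trans (leq_maxl _ _) Nn.
have nuC n e : 0 < e -> exists N, forall M, (N <= M)%N -> nu n (~` E M) <= e.
  move=> e0; apply: (Rintegral_dct0 (fun M => icn n _ (measurableC (mE M))) (icnF n)) => //.
    move=> M' z; rewrite cnE normrM (ger0_norm (cumulant_norm_ge0 _)).
    rewrite ler_piMl ?cumulant_norm_ge0//.
    by rewrite ger0_norm// indicE; case: (_ \in _).
  apply: filterS Eev => z [N EN]; apply: cvg_near_cst; exists N => // M' /= NM.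
  by rewrite cnE indicE memNset ?mul0r// => /(_ (ndE _ _ NM z EN)).
have nuF N e : 0 < e -> exists M, forall n, (M <= n)%N -> nu n (E N) <= e.
  move=> e0.
  have iK : mu.-integrable setT (EFin \o (fun z => 2 * M * \1_(K N) z)).
    have [mK Kfin] := Koo N.
    apply: RintegrableZ; apply/integrableP; split.
      by apply/measurable_EFinP; exact: measurable_indic.
    under eq_integral => z _ do rewrite /= ger0_norm//.
    by rewrite integral_indic// setIT.
  (* The shift by [N] makes the bound on [E N] hold for every term of the sequence, not only for
     late ones. *)
  have [||N0 HN0] := Rintegral_dct0 (fun n => icn (n + N)%N _ (mE N)) iK _ _ e0.
  - move=> n z; rewrite cnE normrM (ger0_norm (cumulant_norm_ge0 _)).
    rewrite ger0_norm// !indicE; have [|] := boolP (z \in E N).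
      rewrite inE => -[KN /(_ (n + N)%N I)/= /(_ (leq_addl _ _)) nz].
      by rewrite mem_set// mul1r mulr1 cnM.
    by move=> _; rewrite mul0r mulr_ge0.
  - apply: filterS F0 => z Fz.
    have cz : (fun n => cumulant_norm (coef (F (n + N)%N) z)) @ \oo --> (0 : R).
      exact: (cvg_comp (fun n => n + N)%N (fun n => cumulant_norm (coef (F n) z))
        (cvg_addnr N) (cn_cvg _ Fz)).
    apply: norm_cvg0; apply: (squeeze_cvgr _ (cvg_cst 0) cz); apply: nearW => n.
    rewrite normr_ge0/= cnE normrM (ger0_norm (cumulant_norm_ge0 _)).
    rewrite ler_piMl ?cumulant_norm_ge0//.
    by rewrite ger0_norm// indicE; case: (_ \in _).
  exists (N0 + N)%N => n Nn; rewrite -(@subnK N n) ?(leq_trans (leq_addl _ _) Nn)//.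
  by apply: HN0; rewrite leq_subRL ?(leq_trans (leq_addl _ _) Nn)// addnC.
have nuU n A B C : measurable A -> measurable B -> measurable C ->
    A `<=` B `|` C -> nu n A <= nu n B + nu n C.
  move=> mA mB mC ABC; rewrite /nu.
  have /= <- := RintegralD measurableT (icn n _ mB) (icn n _ mC).
  apply: le_Rintegral => //; first exact: icn.
    exact: RintegrableD (icn n _ mB) (icn n _ mC).
  move=> z _; rewrite !cnE -mulrDl ler_wpM2r ?cumulant_norm_ge0// !indicE.
  have [|_] := boolP (z \in A); last by rewrite addr_ge0.
  by rewrite inE => /ABC[zB|zC]; [rewrite (mem_set zB) lerDl|rewrite (mem_set zC) lerDr].
have [A [mA hA hAc]] := sliding_hump nuU mE ndE nuC nuF.
have le_nu n B : measurable B -> cosdef P (lin Lambda (restr B (F n))) <= nu n B.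
  by move=> mB; apply: (cosdef_lin_le); exact: B0_all_restr.
move=> e e0; have e'0 : 0 < e / 42 by rewrite divr_gt0.
have [N1 HN1] := cauchy A _ mA e'0.
have [N2 HN2] := cauchy setT _ measurableT e'0.
have trg G G' : cosdef P (lin Lambda G) <=
    2 * (cosdef P (fun w => lin Lambda G w - lin Lambda G' w) + cosdef P (lin Lambda G')).
  rewrite (eq_cosdef P (W := fun w => (lin Lambda G w - lin Lambda G' w) + lin Lambda G' w)).
    by apply: cosdefD => //; exact: measurable_funB.
  by move=> w; rewrite subrK.
(* The sliding hump gives single late indices only. The Cauchy property over [A] carries smallness
   from [n1] to all later indices, among them [n2], where the complement is small too; the Cauchy
   property over the whole space then carries it from [n2] to all [n]. *)
have [n1 Nn1 nu1] := hA _ N1 e'0.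
have smallA n : (N1 <= n)%N -> cosdef P (lin Lambda (restr A (F n))) <= 4 * (e / 42).
  move=> Nn; rewrite (le_trans (trg _ (restr A (F n1))))//.
  by have := HN1 n n1 Nn Nn1; have := le_nu n1 A mA; lra.
have [n2 Nn2 nu2] := hAc _ (maxn N1 N2) e'0.
move: Nn2; rewrite geq_max => /andP[N1n2 N2n2].
have small2 : cosdef P (lin Lambda (F n2)) <= 20 * (e / 42).
  have mAc := measurableC mA.
  have BA := B0_all_restr mA (BF n2); have BAc := B0_all_restr mAc (BF n2).
  rewrite (le_trans (cosdef_le_eq_coef (BF n2) (B0_all_cat BA BAc) _))//.
    move=> z; rewrite coef_cat !coef_restr -scalerDl !indicE in_setC.
    by case: (_ \in _); rewrite ?addr0 ?add0r scale1r.
  rewrite (eq_cosdef P (W := fun w => lin Lambda (restr A (F n2)) w +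
    lin Lambda (restr (~` A) (F n2)) w)); last by move=> w; rewrite lin_cat.
  exact: arith (cosdefD P (mlin _) (mlin _)) (smallA n2 N1n2) (le_nu n2 _ mAc) nu2.
exists N2 => n N2n.
have restrT G : restr setT G = G.
  by rewrite /restr -[RHS]map_id; apply: eq_map => -[c B] /=; rewrite setTI.
have := HN2 n n2 N2n N2n2; rewrite !restrT => cn.
exact: arith2 (trg _ (F n2)) cn small2.
Qed.

(** * Approximating sequences and their uniqueness *)

Local Notation simple_seq := (nat -> seq ('cV[R]_d * set SR)).

(** The scalar counterpart of [is_levy_integral]. A Cauchy condition replaces the existence of
    limits over each [A]: it involves the sequence alone, and is preserved by sums and by
    translations. *)
Definition regular (F : simple_seq) (g : SR -> 'cV[R]_d) :=
  [/\ forall n, B0_all rho (F n),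
      {ae mu, forall z, (fun n => coef (F n) z) @ \oo --> g z} &
      forall A e, measurable A -> 0 < e -> exists N, forall n m,
        (N <= n)%N -> (N <= m)%N ->
        cosdef P (fun w => lin Lambda (restr A (F n)) w -
                           lin Lambda (restr A (F m)) w) <= e].

Definition cosdef_cvg (F : simple_seq) (V : Omega -> R) :=
  forall e, 0 < e -> exists N, forall n, (N <= n)%N ->
    cosdef P (fun w => lin Lambda (F n) w - V w) <= e.

Lemma cosdefDB (V V' W W' : Omega -> R) :
  measurable_fun setT V -> measurable_fun setT V' ->
  measurable_fun setT W -> measurable_fun setT W' ->
  cosdef P (fun w => (V w + W w) - (V' w + W' w)) <=
  2 * (cosdef P (fun w => V w - V' w) + cosdef P (fun w => W w - W' w)).
Proof.
move=> mV mV' mW mW'.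
rewrite (eq_cosdef P (W := fun w => (V w - V' w) + (W w - W' w))).
  by apply: cosdefD; exact: measurable_funB.
by move=> w; ring.
Qed.

Lemma regular_cat (F G : simple_seq) f g : regular F f -> regular G g ->
  regular (fun n => F n ++ G n) (fun z => f z + g z).
Proof.
move=> [BF cF kF] [BG cG kG]; split.
- by move=> n; exact: B0_all_cat.
- apply: filterS2 cF cG => z a b.
  rewrite (_ : (fun n => _) = (fun n => coef (F n) z + coef (G n) z)).
    exact: cvgD.
  by apply/funext => n; rewrite coef_cat.
- move=> A e mA e0; have e4 : 0 < e / 4 by rewrite divr_gt0.
  have [N1 H1] := kF A _ mA e4; have [N2 H2] := kG A _ mA e4.
  exists (maxn N1 N2) => n m; rewrite !geq_max => /andP[n1 n2] /andP[m1 m2].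
  have {}H1 := H1 n m n1 m1; have {}H2 := H2 n m n2 m2.
  rewrite (eq_cosdef P (W := fun w =>
    (lin Lambda (restr A (F n)) w + lin Lambda (restr A (G n)) w) -
    (lin Lambda (restr A (F m)) w + lin Lambda (restr A (G m)) w))); last first.
    by move=> w; rewrite !restr_cat !lin_cat.
  apply: le_trans (cosdefDB (mlin _) (mlin _) (mlin _) (mlin _)) _; lra.
Qed.

Lemma regular_opp (F : simple_seq) f : regular F f ->
  regular (fun n => opp_coef (F n)) (fun z => - f z).
Proof.
move=> [BF cF kF]; split.
- by move=> n; exact: B0_all_opp.
- apply: filterS cF => z a.
  rewrite (_ : (fun n => _) = (fun n => - coef (F n) z)); first exact: cvgN.
  by apply/funext => n; rewrite coef_opp.
- move=> A e mA e0; have [N1 H1] := kF A _ mA e0; exists N1 => n m n1 m1.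
  rewrite (eq_cosdef P (W := fun w => - (lin Lambda (restr A (F n)) w -
      lin Lambda (restr A (F m)) w))); first by rewrite cosdefN; exact: H1.
  by move=> w; rewrite !restr_opp !lin_opp; ring.
Qed.

Lemma cosdef_translateB t F G : B0_all rho F -> B0_all rho G ->
  cosdef P (fun w => lin Lambda (translate t F) w - lin Lambda (translate t G) w) =
  cosdef P (fun w => lin Lambda F w - lin Lambda G w).
Proof.
move=> BF BG.
have tE : translate t F ++ opp_coef (translate t G) = translate t (F ++ opp_coef G).
  by rewrite /translate map_cat /opp_coef -!map_comp.
rewrite -(eq_cosdef P (V := lin Lambda (translate t (F ++ opp_coef G)))); last first.
  by move=> w; rewrite -tE lin_cat lin_opp.
rewrite (cosdef_translate t (B0_all_cat BF (B0_all_opp BG))).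
by apply: eq_cosdef => w; rewrite lin_cat lin_opp.
Qed.

Lemma ae_translate t (p : SR -> Prop) : {ae mu, forall z, p z} ->
  {ae mu, forall z, p (z.1, z.2 - t)}.
Proof.
move=> [N [mN N0 pN]].
exists ((fun z : SR => (z.1, z.2 - t)) @^-1` N); split.
- by rewrite -[X in measurable X]setTI; exact: measurable_translateSR.
- by have := Pi_translate rho t mN; rewrite /Pi N0.
- by move=> z nz; exact: pN.
Qed.

Lemma regular_translate t (F : simple_seq) f : regular F f ->
  regular (fun n => translate t (F n)) (fun z => f (z.1, z.2 - t)).
Proof.
move=> [BF cF kF]; split.
- by move=> n; exact: B0_all_translate.
- apply: filterS (ae_translate t cF) => z a.
  rewrite (_ : (fun n => _) = (fun n => coef (F n) (z.1, z.2 - t)))//.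
  by apply/funext => n; rewrite coef_translate.
- move=> A e mA e0.
  pose A' := (fun z : SR => (z.1, z.2 + t)) @^-1` A.
  have mA' : measurable A'.
    have := @measurable_translateSR R S l (- t) measurableT A mA.
    by rewrite setTI /A'; under [X in X @^-1` _]eq_fun do rewrite opprK.
  have [N1 H1] := kF A' _ mA' e0; exists N1 => n m n1 m1.
  rewrite !restr_translate cosdef_translateB; first exact: H1.
  + exact: B0_all_restr.
  + exact: B0_all_restr.
Qed.

(** The difference of the two sequences is again regular, with limit 0, and so falls under
    [cosdef_lin_cvg0]. *)
Lemma regular_unique (F G : simple_seq) g : regular F g -> regular G g ->
  forall e, 0 < e -> exists N, forall n, (N <= n)%N ->
    cosdef P (fun w => lin Lambda (F n) w - lin Lambda (G n) w) <= e.
Proof.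
move=> rF rG e e0; have [BH cH kH] := regular_cat rF (regular_opp rG).
have cH0 : {ae mu, forall z,
    (fun n => coef (F n ++ opp_coef (G n)) z) @ \oo --> (0 : 'cV[R]_d)}.
  by apply: filterS cH => z; rewrite subrr.
have [N HN] := cosdef_lin_cvg0 BH cH0 kH e0.
exists N => n Nn; apply: le_trans (HN n Nn).
by rewrite (@eq_cosdef _ _ _ P _ (lin Lambda (F n ++ opp_coef (G n))))// => w;
  rewrite lin_cat lin_opp.
Qed.

Lemma cosdef_cvg_cat (F G : simple_seq) V W : measurable_fun setT V -> measurable_fun setT W ->
  cosdef_cvg F V -> cosdef_cvg G W ->
  cosdef_cvg (fun n => F n ++ G n) (fun w => V w + W w).
Proof.
move=> mV mW FV GW e e0; have e4 : 0 < e / 4 by rewrite divr_gt0.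
have [N1 H1] := FV _ e4; have [N2 H2] := GW _ e4.
exists (maxn N1 N2) => n; rewrite !geq_max => /andP[n1 n2].
have {}H1 := H1 n n1; have {}H2 := H2 n n2.
rewrite (eq_cosdef P (W := fun w =>
  (lin Lambda (F n) w + lin Lambda (G n) w) - (V w + W w))); last first.
  by move=> w; rewrite lin_cat.
apply: le_trans (cosdefDB (mlin _) mV (mlin _) mW) _; lra.
Qed.

(** For a fixed list [cumulant_norm (coef F z)] is integrable, so its integral outside a growing
    ball in the second variable vanishes. The bounded support obtained here is what a large
    translation can move away. *)
Lemma cosdef_restr_bounded F : B0_all rho F -> forall e, 0 < e ->
  exists r : R,
  let A := [set z : SR | `|z.2| < r] in measurable A /\
  cosdef P (fun w => lin Lambda F w - lin Lambda (restr A F) w) <= e.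
Proof.
move=> BF e e0; pose A n : set SR := [set z : SR | `|z.2| < n%:R].
have mA n : measurable (A n).
  rewrite (_ : A n = setT `*` [set v : 'cV[R]_l | `|v| < n%:R]).
    apply: measurableX => //; apply: sub_sigma_algebra.
    apply: (@open_comp _ _ (fun v : 'cV[R]_l => `|v|) [set x | x < n%:R]); last exact: open_lt.
    by move=> v _; exact: norm_continuous.
  by apply/seteqP; split => z //= [].
have BR n : B0_all rho (F ++ opp_coef (restr (A n) F)).
  by apply: B0_all_cat => //; apply: B0_all_opp; exact: B0_all_restr.
have cE n z : coef (F ++ opp_coef (restr (A n) F)) z = \1_(~` A n) z *: coef F z.
  rewrite coef_cat coef_opp coef_restr !indicE in_setC.
  by case: (_ \in _); rewrite ?scale1r ?scale0r ?subrr ?subr0.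
have cnE n z : cumulant_norm (coef (F ++ opp_coef (restr (A n) F)) z) =
    \1_(~` A n) z * cumulant_norm (coef F z).
  rewrite cE indicE; case: (_ \in _); first by rewrite scale1r mul1r.
  by rewrite scale0r mul0r cumulant_norm0.
have iF := integrable_cumulant_norm BF.
have cv : (fun n => \int[mu]_z cumulant_norm (coef (F ++ opp_coef (restr (A n) F)) z))
    @ \oo --> (0 : R).
  have c1 : {ae mu, forall z, setT z ->
      (fun n => (cumulant_norm (coef (F ++ opp_coef (restr (A n) F)) z))%:E) @ \oo --> 0%E}.
    apply: aeW => z _; apply: cvg_near_cst.
    exists (Num.Def.truncn `|z.2|).+1 => // n /= zn.
    rewrite cnE indicE memNset ?mul0r//; apply; rewrite /A /=.
    by rewrite (lt_le_trans (truncnS_gt _))// ler_nat.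
  have d1 : {ae mu, forall z n, setT z ->
      (`|(cumulant_norm (coef (F ++ opp_coef (restr (A n) F)) z))%:E| <=
       (cumulant_norm (coef F z))%:E)%E}.
    apply: aeW => z n _; rewrite abse_EFin lee_fin.
    rewrite (ger0_norm (cumulant_norm_ge0 _)) cnE.
    apply: ler_piMl; first exact: cumulant_norm_ge0.
    by rewrite indicE; case: (_ \in _).
  have [_ _] := dominated_convergence measurableT
    (fun n => measurable_int _ (integrable_cumulant_norm (BR n)))
    (measurable_cst 0%E) c1 iF d1.
  rewrite integral0 => cv.
  by have -> : (0 : R) = fine 0%E by []; apply: fine_cvg; exact: cv.
move/cvgr0_norm_le: cv => /(_ e e0)[N _ /(_ N (leqnn _)) HN].
exists N%:R => /=; split; first exact: mA.
rewrite (eq_cosdef P (W := lin Lambda (F ++ opp_coef (restr (A N) F)))); last first.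
  by move=> w; rewrite lin_cat lin_opp.
apply: le_trans (cosdef_lin_le (BR N)) _.
exact: le_trans (ler_norm _) HN.
Qed.

Lemma cvg_matrix m n (M : nat -> 'M[R]_(m, n)) (M0 : 'M[R]_(m, n)) :
  (forall i j, (fun k => M k i j) @ \oo --> M0 i j) -> M @ \oo --> M0.
Proof.
move=> MM A [B nB BA].
have : \forall k \near \oo, forall i j, B i j (M k i j).
  by apply: filter_forall => i; apply: filter_forall => j; exact: MM (nB i j).
by apply: filterS => k; exact: BA.
Qed.

Lemma cvg_trmx_mulmx m n (M : nat -> 'M[R]_(m, n)) (M0 : 'M[R]_(m, n))
    (x : 'cV[R]_m) :
  M @ \oo --> M0 -> (fun k => (M k)^T *m x) @ \oo --> M0^T *m x.
Proof.
move=> MM; apply: cvg_matrix => i j; rewrite mxE.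
rewrite (_ : (fun k => _) = (fun k => \sum_u (M k)^T i u * x u j)); last first.
  by apply/funext => k; rewrite mxE.
apply: cvg_big => [|u _]; first exact: add_continuous.
apply: cvgM; last exact: cvg_cst.
rewrite mxE (_ : (fun k => _) = (fun k => M k u i)); last first.
  by apply/funext => k; rewrite mxE.
exact: (cvg_comp _ (fun N : 'M[R]_(m, n) => N u i) MM (@coord_continuous _ _ _ u i M0)).
Qed.

(** * Matrix-valued integrands and moving averages *)

Context (q : nat).

Let mRV k (V : {RV P >-> 'cV[R]_k}) : measurable_fun setT V.
Proof. exact: measurable_funP. Qed.

Definition scalarize (theta : 'cV[R]_q) (h : simple_integrand (S := S) l d q rho) :
    seq ('cV[R]_d * set SR) :=
  [seq ((si_val i)^T *m theta, si_set i) | i : 'I_(si_size h)].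

Lemma B0_all_scalarize theta h : B0_all rho (scalarize theta h).
Proof. by move=> _ /mapP[i _ ->]; exact: si_setP. Qed.

Lemma lin_scalarize theta h A w :
  lin Lambda (restr A (scalarize theta h)) w = dotp theta (si_integral Lambda h A w).
Proof.
rewrite /lin /restr /scalarize 2!big_map big_enum/= /si_integral dotp_sumr.
apply: eq_bigr => i _.
by rewrite dotp_mulmx.
Qed.

Lemma coef_scalarize theta h z : coef (scalarize theta h) z = (si_fun h z)^T *m theta.
Proof.
rewrite /coef /scalarize big_map big_enum/= /si_fun raddf_sum mulmx_suml.
apply: eq_bigr => i _; rewrite scalemxAl; congr (_ *m _).
by apply/matrixP => a b; rewrite !mxE.
Qed.

Lemma measurable_si_integral (h : simple_integrand (S := S) l d q rho) A :
  measurable_fun setT (si_integral Lambda h A).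
Proof.
apply/measurable_mxP => i j.
rewrite (_ : (fun w => _) = (fun w =>
    \sum_(k < si_size h) \sum_u si_val k i u * Lambda (A `&` si_set k) w u j)); last first.
  apply/funext => w; rewrite /si_integral summxE; apply: eq_bigr => k _.
  by rewrite mxE.
apply: measurable_sum => k; apply: measurable_sum => u.
apply: measurable_funM => //.
by have /measurable_mxP := mRV (Lambda (A `&` si_set k)); exact.
Qed.

(** Passing to the transpose, <theta, M x> = <M' theta, x>, turns the matrix-valued integrand into a
    vector-valued one. Convergence over each [A] yields the Cauchy property by comparison with the
    limit. *)
Lemma levy_integral_regular (theta : 'cV[R]_q) (g : SR -> 'M[R]_(q, d))
    (V : {RV P >-> 'cV[R]_q}) : is_levy_integral rho Lambda g V ->
  exists F : simple_seq, regular F (fun z => (g z)^T *m theta) /\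
            cosdef_cvg F (fun w => dotp theta (V w)).
Proof.
move=> [h [hg hA hV]]; exists (fun n => scalarize theta (h n)); split; first split.
- by move=> n; exact: B0_all_scalarize.
- apply: filterS hg => z hz.
  rewrite (_ : (fun n => _) = (fun n => (si_fun (h n) z)^T *m theta)); last first.
    by apply/funext => n; rewrite coef_scalarize.
  exact: cvg_trmx_mulmx.
- move=> A e mA e0; have [VA hVA] := hA A mA.
  have e4 : 0 < e / 4 by rewrite divr_gt0.
  have [N HN] := cvg_in_probability_cosdef theta
    (fun n => measurable_si_integral (h n) A) (mRV VA) hVA e4.
  exists N => n m Nn Nm.
  have Hn := HN n Nn; have Hm := HN m Nm.
  have mdV : measurable_fun setT (fun w => dotp theta (VA w)).
    by apply: measurableT_comp => //; exact: measurable_dotp.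
  have := cosdef_triangle P (measurable_lin Lambda (restr A (scalarize theta (h n))))
    mdV (measurable_lin Lambda (restr A (scalarize theta (h m)))).
  have lE n' w : lin Lambda (restr A (scalarize theta (h n'))) w - dotp theta (VA w) =
      dotp theta (si_integral Lambda (h n') A w) - dotp theta (VA w).
    by rewrite lin_scalarize.
  rewrite (eq_cosdef P (lE n)) (cosdefBC P (fun w => dotp theta (VA w))).
  rewrite (eq_cosdef P (lE m)); lra.
- move=> e e0.
  have [N HN] := cvg_in_probability_cosdef theta
    (fun n => measurable_si_integral (h n) setT) (mRV V) hV e0.
  exists N => n /HN; rewrite (eq_cosdef P (W := fun w =>
    lin Lambda (scalarize theta (h n)) w - dotp theta (V w)))// => w.
  rewrite -lin_scalarize; congr (lin _ _ _ - _).
  by rewrite /restr -[RHS]map_id; apply: eq_map => -[c B] /=; rewrite setTI.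
Qed.

Lemma mma_field_regular (f : SR -> 'M[R]_(q, d)) (Y : 'cV[R]_l -> {RV P >-> 'cV[R]_q})
    m (theta : 'I_m -> 'cV[R]_q) (p : 'I_m -> 'cV[R]_l) (s : seq 'I_m) :
  mma_field rho Lambda f Y ->
  exists F : simple_seq, regular F (fun z => \sum_(i <- s) (f (z.1, p i - z.2))^T *m theta i) /\
            cosdef_cvg F (fun w => \sum_(i <- s) dotp (theta i) (Y (p i) w)).
Proof.
move=> mma; elim: s => [|i s [F [rF cF]]].
  exists (fun=> [::]); split; first split.
  - by move=> n p'; rewrite inE.
  - apply: aeW => z; rewrite big_nil.
    rewrite (_ : (fun n => _) = (fun=> 0)); first exact: cvg_cst.
    by apply/funext => n; rewrite /coef big_nil.
  - move=> A e _ e0; exists 0%N => n m' _ _; rewrite (eq_cosdef P (W := fun=> 0)).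
      by rewrite /cosdef cos0 subrr (Rintegral_cst1 P) ltW.
    by move=> w; rewrite /lin !big_nil subrr.
  - move=> e e0; exists 0%N => n _; rewrite (eq_cosdef P (W := fun=> 0)).
      by rewrite /cosdef cos0 subrr (Rintegral_cst1 P) ltW.
    by move=> w; rewrite /lin !big_nil subrr.
have [_ int_i] := mma (p i).
have [G [rG cG]] := levy_integral_regular (theta i) int_i.
exists (fun n => G n ++ F n); split.
  have [rB rC rK] := regular_cat rG rF; split; [exact: rB| |exact: rK].
  by apply: filterS rC => z; rewrite big_cons.
move=> e e0; have [||N HN] := cosdef_cvg_cat _ _ cG cF e0.
- by apply: measurableT_comp => //; exact: measurable_dotp.
- apply: measurable_sum => j.
  by apply: measurableT_comp => //; exact: measurable_dotp.
exists N => n Nn; apply: le_trans (HN n Nn).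
rewrite le_eqVlt; apply/orP; left; apply/eqP; apply: eq_cosdef => w.
by rewrite big_cons.
Qed.

Section mma_field.
Variables (f : SR -> 'M[R]_(q, d)) (Y : 'cV[R]_l -> {RV P >-> 'cV[R]_q}).
Hypothesis mma : mma_field rho Lambda f Y.
Variable m : nat.

Definition field_comb (theta : 'I_m -> 'cV[R]_q) (p : 'I_m -> 'cV[R]_l)
    (t : 'cV[R]_l) (w : Omega) : R :=
  \sum_i dotp (theta i) (Y (p i + t) w).

Lemma measurable_field_comb theta p t : measurable_fun setT (field_comb theta p t).
Proof.
apply: measurable_sum => i; apply: measurableT_comp; first exact: measurable_dotp.
exact: measurable_funP.
Qed.

(** One index [j0], chosen at time 0, has to serve every [t]. The chain runs from
    [translate t (F j0)] to [translate t (F n)], then to the sequence [G n] obtained at [t], then to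
    the field. The first distance does not depend on [t], by translation invariance; the second is
    small by uniqueness, since both sequences are regular for the kernels at [t]. The index [n]
    depends on [t] but disappears from the conclusion. *)
Lemma field_comb_approx (theta : 'I_m -> 'cV[R]_q) (p : 'I_m -> 'cV[R]_l) (e : R) :
  0 < e -> exists (v : seq ('cV[R]_d * set SR)) (r : R),
  [/\ B0_all rho v, forall z, r <= `|z.2| -> coef v z = 0 &
      forall t, cosdef P (fun w => lin Lambda (translate t v) w -
                                   field_comb theta p t w) <= e].
Proof.
have arith (s a b x y c : R) : s <= 2 * (a + b) -> a <= x -> b <= y ->
  2 * (x + y) <= c -> s <= c by lra.
(* In units of e / 64, the two halves of the chain cost 2 (1 + 1) = 4 each and together 2 (4 + 4) =
   16; with the truncation of the support this makes 2 (1 + 16) = 34. *)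
move=> e0; have e64 : 0 < e / 64 by rewrite divr_gt0.
have mfc t := measurable_field_comb theta p t.
have app t := mma_field_regular theta (fun i => p i + t) (enum 'I_m) mma.
have [F [rF cF]] := app 0; have [BF _ _] := rF.
have cF' t (G : simple_seq) : cosdef_cvg G
      (fun w => \sum_(i <- enum 'I_m) dotp (theta i) (Y (p i + t) w)) ->
    cosdef_cvg G (field_comb theta p t).
  move=> cG x x0; have [N HN] := cG x x0; exists N => n Nn.
  apply: le_trans (HN n Nn); rewrite le_eqVlt; apply/orP; left; apply/eqP.
  by apply: eq_cosdef => w; rewrite /field_comb big_enum.
have {}cF := cF' _ _ cF.
have [j0 Hj0] := cF _ e64.
have near_t t : cosdef P (fun w => lin Lambda (translate t (F j0)) w -
    field_comb theta p t w) <= 16 * (e / 64).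
  have [G [rG cG]] := app t; have {}cG := cF' _ _ cG.
  have rtF := regular_translate t rF.
  have rtF' : regular (fun n => translate t (F n))
      (fun z => \sum_(i <- enum 'I_m) (f (z.1, p i + t - z.2))^T *m theta i).
    case: rtF => [tB tc tK]; split; [exact: tB| |exact: tK].
    apply: filterS tc => z /=; under eq_bigr do rewrite addr0 opprB addrA.
    by [].
  have [N1 HN1] := regular_unique rtF' rG e64.
  have [N2 HN2] := cG _ e64.
  pose n := maxn j0 (maxn N1 N2).
  have nj0 : (j0 <= n)%N by exact: leq_maxl.
  have nN1 : (N1 <= n)%N by rewrite (leq_trans (leq_maxl N1 N2))// leq_maxr.
  have nN2 : (N2 <= n)%N by rewrite (leq_trans (leq_maxr N1 N2))// leq_maxr.
  have s1 := arith _ _ _ _ _ (4 * (e / 64))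
    (cosdef_triangle P (mlin (F j0)) (mfc 0) (mlin (F n))) (Hj0 _ (leqnn _)).
  rewrite cosdefBC in s1; have {}s1 := s1 _ (Hj0 n nj0) _.
  have s2 := arith _ _ _ _ _ (4 * (e / 64))
    (cosdef_triangle P (mlin (translate t (F n))) (mlin (G n)) (mfc t))
    (HN1 n nN1) (HN2 n nN2) _.
  apply: (arith _ _ _ _ _ (16 * (e / 64))
    (cosdef_triangle P (mlin (translate t (F j0))) (mlin (translate t (F n))) (mfc t))).
  - rewrite (cosdef_translateB t (BF j0) (BF n)); apply: s1; lra.
  - apply: s2; lra.
  - lra.
have [r [mA rA]] := cosdef_restr_bounded (BF j0) e64.
set A := [set z | _] in mA rA.
have Bv : B0_all rho (restr A (F j0)) by exact: B0_all_restr.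
exists (restr A (F j0)), r; split; first exact: Bv.
  move=> z rz; rewrite coef_restr indicE memNset ?scale0r// /A /=.
  by rewrite ltNge rz.
move=> t; apply: (arith _ _ _ _ _ e
  (cosdef_triangle P (mlin (translate t (restr A (F j0))))
    (mlin (translate t (F j0))) (mfc t)) _ (near_t t)).
- rewrite (cosdef_translateB t Bv (BF j0)) cosdefBC; exact: rA.
- lra.
Qed.

Lemma charf_field_comb_mixing (th1 th2 : 'I_m -> 'cV[R]_q) (s p : 'I_m -> 'cV[R]_l)
    (t : nat -> 'cV[R]_l) :
  (fun n => `|t n|) @ \oo --> +oo ->
  forall e, 0 < e -> exists N, forall n, (N <= n)%N ->
  cnorm1 (charf P (fun w => field_comb th1 s 0 w + field_comb th2 p (t n) w) -
          charf P (field_comb th1 s 0) * charf P (field_comb th2 p 0)) <= e.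
Proof.
have arith2 (x a b : R) : a <= x -> b <= x -> 2 * (a + b) <= 4 * x by lra.
have fin (x y z z' w w' c1 de : R) : x <= y + (z + w) -> y <= 2 * (1 + 4) * de ->
    z <= z' * (2 * (1 + 1) * de) -> z' <= 2 -> w <= 2 * (1 + 1) * de * w' -> w' <= 2 ->
    0 < de -> 26 * de <= c1 -> x <= c1 by nra.
(* The joint term has defect at most 2 (1 + 1) [de ^+ 2], hence costs 2 (1 + 4) [de]; each of the
   two factors of the product costs 4 [de], times the bound 2 on the other. The total is (10 + 8 +
   8) [de]. *)
move=> too e e0; pose de := e / 26; have de0 : 0 < de by rewrite divr_gt0.
have mfc th x r := measurable_field_comb th x r.
have dd0 : 0 < de ^+ 2 by rewrite exprn_gt0.
have [u [r1 [Bu u0 Ju]]] := field_comb_approx th1 s dd0.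
have [v [r2 [Bv v0 Jv]]] := field_comb_approx th2 p dd0.
have [N _ HN] : \forall n \near \oo, r1 + r2 <= `|t n| by exact: (cvgryPge _).1 too _.
exists N => n Nn; have rt : r1 + r2 <= `|t n| := HN n Nn.
(* The translation by 0 is kept so that the estimate of [field_comb_approx] at time 0 applies
   literally. *)
pose U := lin Lambda (translate 0 u).
pose V x := lin Lambda (translate x v).
have BtU : B0_all rho (translate 0 u) by exact: B0_all_translate.
have BtV x : B0_all rho (translate x v) by exact: B0_all_translate.
have prod_UV : charf P (fun w => U w + V (t n) w) = charf P U * charf P (V 0).
  rewrite [charf P (V 0)](charf_translate 0 Bv) -(charf_translate (t n) Bv).
  apply: (charf_lin_disjoint BtU (BtV (t n))) => z.
  rewrite !coef_translate subr0.
  have [r1z|zr1] := leP r1 `|z.2|; first by left; apply: u0.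
  right; apply: v0 => /=.
  (* From |t n| >= r1 + r2 and |z.2| < r1 it follows that |z.2 - t n| >= r2, outside the support of
     [v]. *)
  have := ler_distD (z.2) 0 (t n); rewrite !sub0r !normrN => tn.
  by move: rt zr1 tn; lra.
have mUV : measurable_fun setT (fun w => U w + V (t n) w).
  by apply: measurable_funD; exact: mlin.
have mF : measurable_fun setT
    (fun w => field_comb th1 s 0 w + field_comb th2 p (t n) w).
  by apply: measurable_funD; exact: mfc.
have mU : measurable_fun setT U by exact: mlin.
have mV x : measurable_fun setT (V x) by exact: mlin.
have d1 : cnorm1 (charf P (fun w => field_comb th1 s 0 w + field_comb th2 p (t n) w) -
    charf P (fun w => U w + V (t n) w)) <= 2 * (1 + 4) * de.
  apply: (cnorm1_charfB mF mUV de0).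
  apply: (le_trans (cosdefDB (mfc th1 s 0) mU (mfc th2 p (t n)) (mV (t n)))).
  rewrite cosdefBC [X in _ + X]cosdefBC; exact: arith2 (Ju 0) (Jv (t n)).
have d2 : cnorm1 (charf P U - charf P (field_comb th1 s 0)) <= 2 * (1 + 1) * de.
  by apply: (cnorm1_charfB mU (mfc _ _ _) de0); rewrite mul1r; exact: Ju.
have d3 : cnorm1 (charf P (V 0) - charf P (field_comb th2 p 0)) <= 2 * (1 + 1) * de.
  by apply: (cnorm1_charfB (mV 0) (mfc _ _ _) de0); rewrite mul1r; exact: Jv.
set A := charf P (fun w => _) in d1 *.
set B := charf P (field_comb th1 s 0) in d2 *.
set C := charf P (field_comb th2 p 0) in d3 *.
have E : A - B * C = (A - charf P (fun w => U w + V (t n) w)) +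
    (charf P U * (charf P (V 0) - C) + (charf P U - B) * C).
  by rewrite prod_UV; ring.
rewrite E.
apply: (fin _ _ _ (cnorm1 (charf P U)) _ (cnorm1 C) _ de
  (le_trans (cnorm1D _ _) (lerD (lexx _) (cnorm1D _ _))) d1) => //.
- apply: le_trans (cnorm1M _ _) _.
  by apply: ler_wpM2l; [exact: cnorm1_ge0|exact: d3].
- exact: cnorm1_charf mU.
- apply: le_trans (cnorm1M _ _) _.
  by apply: ler_wpM2r; [exact: cnorm1_ge0|exact: d2].
- exact: cnorm1_charf (mfc _ _ _).
- by rewrite /de mulrC divfK.
Qed.

End mma_field.

End levy_basis_theory.

(** * Mixing *)

Section finite_dimensional_laws.
Context {R : realType} (l q : nat).

Lemma dotp_stack (Omega : Type) (X : 'cV[R]_l -> Omega -> 'cV[R]_q) m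
    (A : 'M[R]_(m, q)) (s : 'I_m -> 'cV[R]_l) w :
  dotp (mxvec A)^T (stack X s w) = \sum_i dotp (row i A)^T (X (s i) w).
Proof.
rewrite /dotp /stack (reindex _ (curry_mxvec_bij m q))/=.
rewrite pair_big/=; apply: eq_bigr => -[i j] _ /=.
by rewrite !mxE !mxvecE !mxE.
Qed.

Lemma measurable_stack d (Omega : measurableType d) (P : probability Omega R)
    (X : 'cV[R]_l -> {RV P >-> 'cV[R]_q}) m (s : 'I_m -> 'cV[R]_l) :
  measurable_fun setT (stack X s).
Proof.
apply/measurable_mxP => k j.
rewrite (ord1 j); case/mxvec_indexP: k => i u.
rewrite (_ : (fun w => _) = (fun w => X (s i) w u 0)); last first.
  by apply/funext => w; rewrite /stack mxE mxvecE mxE.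
have /measurable_mxP : measurable_fun setT (X (s i)) by exact: measurable_funP.
exact.
Qed.

Lemma eq_law_charf d (T : measurableType d) (P : probability T R)
    d' (T' : measurableType d') (P' : probability T' R) k
    (V : T -> 'cV[R]_k) (V' : T' -> 'cV[R]_k) (g : 'cV[R]_k -> R) :
  measurable_fun setT V -> measurable_fun setT V' -> measurable_fun setT g ->
  (forall E, measurable E -> P (V @^-1` E) = P' (V' @^-1` E)) ->
  charf P (fun w => g (V w)) = charf P' (fun w => g (V' w)).
Proof.
move=> mV mV' mg VV'.
have law (h : R -> R) : (forall x, `|h x| <= 1) -> measurable_fun setT h ->
    \int[P]_w h (g (V w)) = \int[P']_w h (g (V' w)).
  move=> h1 mh; have mhg : measurable_fun setT (fun v => (h (g v))%:E).
    by apply/measurable_EFinP; exact: measurableT_comp.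
  have E : (\int[P]_w (h (g (V w)))%:E = \int[P']_w (h (g (V' w)))%:E)%E.
    transitivity (\int[pushforward P V]_v (h (g v))%:E)%E.
      apply/esym; apply: (integral_pushforward mV mhg) => //.
      apply: (@bounded_integrable _ _ _ P (fun w => h (g (V w))) 1) => //.
      exact: measurableT_comp (measurableT_comp mh mg) mV.
    transitivity (\int[pushforward P' V']_v (h (g v))%:E)%E; last first.
      apply: (integral_pushforward mV' mhg) => //.
      apply: (@bounded_integrable _ _ _ P' (fun w => h (g (V' w))) 1) => //.
      exact: measurableT_comp (measurableT_comp mh mg) mV'.
    by apply: eq_measure_integral => A mA _; exact: VV'.
  by rewrite /Rintegral E.
rewrite !charfE (law _ (@cos_norm1 R)) ?(law _ (@sin_norm1 R))//.
- by apply: continuous_measurable_fun; exact: continuous_sin.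
- by apply: continuous_measurable_fun; exact: continuous_cos.
Qed.

End finite_dimensional_laws.

Lemma expC_iD {R : realType} (a b : R) :
  expC ('i%C * a%:C%C + 'i%C * b%:C%C) = expCi (a + b).
Proof. by rewrite /expCi rmorphD mulrDr. Qed.

Theorem theorem3p6 (R : realType) (S : ptopologicalType) (l d q : nat)
    (* the Levy basis and its generating quadruple (gamma, Sigma, Q, rho) *)
    (gamma : 'cV[R]_d) (Sigma : 'M[R]_d)
    (Q : {measure set 'cV[R]_d -> \bar R}) (rho : probability (borel S) R)
    (dO : measure_display) (Omega : measurableType dO) (P : probability Omega R)
    (Lambda : set (borel S * 'cV[R]_l) -> {RV P >-> 'cV[R]_d})
    (f : borel S * 'cV[R]_l -> 'M[R]_(q, d))
    (Y : 'cV[R]_l -> {RV P >-> 'cV[R]_q})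
    (* X may live on another probability space *)
    (dO' : measure_display) (Omega' : measurableType dO')
    (P' : probability Omega' R) (X : 'cV[R]_l -> {RV P' >-> 'cV[R]_q}) :
  levy_basis rho gamma Sigma Q Lambda ->
  measurable_fun setT f ->
  mma_field rho Lambda f Y ->
  eq_fdd X Y ->
  mixing X.
Proof.
move=> LB _ mma XY m s p theta1 theta2 t too.
pose A1 := vec_mx theta1^T; pose A2 := vec_mx theta2^T.
have th1E : theta1 = (mxvec A1)^T by rewrite /A1 vec_mxK trmxK.
have th2E : theta2 = (mxvec A2)^T by rewrite /A2 vec_mxK trmxK.
pose th1 i := (row i A1)^T; pose th2 i := (row i A2)^T.
have law k (r : 'I_k -> 'cV[R]_l) (theta : 'cV[R]_(k * q)) :
    charf P' (fun w => dotp theta (stack X r w)) =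
    charf P (fun w => dotp theta (stack Y r w)).
  apply: eq_law_charf; try exact: measurable_stack; last exact: XY.
  exact: measurable_dotp.
(* [eq_fdd] compares one stack at a time, so the values at [s] and at [p + t n] are joined into a
   single stack over [m + m] points; this transfers their joint law from [X] to [Y]. *)
pose A12 := \matrix_(k < m + m, j < q)
  match fintype.split k with inl i => A1 i j | inr i => A2 i j end.
pose r n (k : 'I_(m + m)) :=
  match fintype.split k with inl i => s i | inr i => p i + t n end.
have joint (O : Type) (Z : 'cV[R]_l -> O -> 'cV[R]_q) n w :
    dotp (mxvec A12)^T (stack Z (r n) w) =
    dotp theta1 (stack Z s w) + dotp theta2 (stack Z (fun i => p i + t n) w).
  rewrite th1E th2E !dotp_stack big_split_ord/=.
  have sl (i : 'I_m) : fintype.split (lshift m i) = inl i := unsplitK (inl i).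
  have sr (i : 'I_m) : fintype.split (rshift m i) = inr i := unsplitK (inr i).
  congr (_ + _); apply: eq_bigr => i _; rewrite /r ?sl ?sr; congr dotp;
    apply/matrixP => a b; do 3!rewrite [LHS]mxE; rewrite ?sl ?sr;
    by do 2!rewrite [RHS]mxE.
apply: cvg_cnorm1 => e e0.
have [N HN] := charf_field_comb_mixing LB mma th1 th2 s p too e0.
exists N => n Nn; apply: le_trans (HN n Nn).
have E1 : charf P (field_comb Y th1 s 0) =
    integralC P' (fun w => expCi (dotp theta1 (stack X s w))).
  rewrite -[RHS]/(charf P' _) law; congr charf; apply/funext => w.
  by rewrite th1E dotp_stack /field_comb; apply: eq_bigr => i _; rewrite addr0.
have E2 : charf P (field_comb Y th2 p 0) =
    integralC P' (fun w => expCi (dotp theta2 (stack X p w))).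
  rewrite -[RHS]/(charf P' _) law; congr charf; apply/funext => w.
  by rewrite th2E dotp_stack /field_comb; apply: eq_bigr => i _; rewrite addr0.
have E12 : charf P (fun w => field_comb Y th1 s 0 w + field_comb Y th2 p (t n) w) =
    integralC P' (fun w =>
     expC ('i%C * (dotp theta1 (stack X s w))%:C%C +
           'i%C * (dotp theta2 (stack X (fun i => p i + t n) w))%:C%C)).
  transitivity (charf P' (fun w => dotp (mxvec A12)^T (stack X (r n) w))).
    rewrite law; congr charf; apply/funext => w; rewrite joint th1E th2E !dotp_stack.
    congr (_ + _); apply: eq_bigr => i _; by rewrite ?addr0.
  congr integralC; apply/funext => w; by rewrite expC_iD joint.
by rewrite E1 E2 E12.
Qed.
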